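(* Let $\Gamma<\mathrm{SL}(2,\mathbb{C})$ be a nontrivial finite subgroup with $r+1$ conjugacy classes, let $I_1,\dots,I_l$ be non-empty subsets of $\{0,\dots,r\}$ with $\bigcup_{i=1}^lI_i=\{0,\dots,r\}$, and let $n\in\mathbb{N}^{r+1}$. Then the product of the cornering morphisms induces a closed immersion $$\mathrm{Hilb}^{n}([\mathbb{C}^2/\Gamma])\longrightarrow\prod_{i=1}^l\mathrm{Quot}_{I_i}^{n_{I_i}}([\mathbb{C}^2/\Gamma]),$$ where $n_{I}$ denotes the restriction of $n$ to the indices in $I$.
   Context: We work over $\mathbb{C}$; modules are left modules, paths are composed from right to left, and products of schemes are over $\mathbb{C}$. Framed McKay quiver. Let $\rho_0=\mathrm{triv},\rho_1,\dots,\rho_r$ be the irreducible representations of $\Gamma$ and $V=\mathbb{C}^2$ the given representation. The McKay graph has vertices $0,\dots,r$ and $\dim\mathrm{Hom}_\Gamma(\rho_j,\rho_i\otimes V)$ edges joining $i$ and $j$ (it is an extended Dynkin diagram of ADE type). The framed McKay graph is obtained by adding a vertex $\infty$ and one edge joining $\infty$ and $0$. The framed McKay quiver $Q$ has vertex set $Q_0=\{\infty,0,\dots,r\}$ and arrow set $Q_1$ consisting of all pairs (edge of the framed McKay graph, orientation of that edge). For $a\in Q_1$, $h(a)$ is its head and $a^*$ is the same edge with the opposite orientation. Algebras. Choose $\epsilon\colon Q_1\to\{\pm1\}$ with $\epsilon(a)\neq\epsilon(a^* )$ for all $a$. The preprojective algebra $\Pi$ is the quotient of $\mathbb{C}Q$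 by the ideal $\langle\sum_{h(a)=i}\epsilon(a)aa^*\mid i\in Q_0\rangle$. Let $A=\Pi/(b^* )$, where $b^*$ is the unique arrow from $0$ to $\infty$. For non-empty $I\subseteq\{0,\dots,r\}$ put $\overline e_I=e_\infty+\sum_{i\in I}e_i\in A$, where the $e_i$ are the vertex idempotents, and $A_I=\overline e_IA\overline e_I$. Moduli spaces. For $m_I\in\mathbb{N}^I$ define the stability condition $\eta_I$ for $A_I$-modules of dimension vector $(1,m_I)$ (dimension $1$ at $\infty$, dimension $m_i$ at $i\in I$) by $\eta_I(\infty)=-\sum_{j\in I}m_j$ and $\eta_I(i)=1$ for $i\in I$. Let $\mathcal{M}_{A_I}(1,m_I)$ be the fine moduli space of $\eta_I$-stable $A_I$-modules of dimension vector $(1,m_I)$, where $M$ is stable if $\eta_I(N)>0$ for all nonzero proper submodules $N$. It carries a tautological bundle $\bigoplus_{i\in\{\infty\}\cup I}T_i$, where $T_\infty$ is trivial and $\mathrm{rk}\,T_i=m_i$. For $I=\{0,\dots,r\}$ one has $A_I=A$, and the moduli space is written $\mathcal{M}_A(1,m)$. Hilbert and Quot schemes. $\mathrm{Quot}_I^{m_I}([\mathbb{C}^2/\Gamma])$ is the Quot scheme of the Kleinian orbifold $[\mathbb{C}^2/\Gamma]$ constructed by Craw–Gammelgaard–Gyenge–Szendrői. They prove that it is isomorphic as a scheme to $\mathcal{M}_{A_I}(1,m_I)$, and for the present purpose it may be taken to be this moduli space. For $I=\{0,\dots,r\}$ and $m\in\mathbb{N}^{r+1}$ one has $\mathrm{Quot}_I^m([\mathbb{C}^2/\Gamma])\cong\mathrm{Hilb}^m([\mathbb{C}^2/\Gamma])$,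 where $$\mathrm{Hilb}^m([\mathbb{C}^2/\Gamma])=\{J\in\mathrm{Hilb}(\mathbb{C}^2)^\Gamma\mid H^0(\mathcal{O}_{\mathbb{C}^2}/J)\cong\textstyle\bigoplus_{i=0}^r\rho_i^{\oplus m_i}\}$$ is a component of the $\Gamma$-fixed locus of the Hilbert scheme of points of $\mathbb{C}^2$. Cornering. For non-empty $I\subseteq\{0,\dots,r\}$ the cornering morphism $\mathrm{Hilb}^m([\mathbb{C}^2/\Gamma])\to\mathrm{Quot}_I^{m_I}([\mathbb{C}^2/\Gamma])$ is, under the identifications $\mathrm{Hilb}^m([\mathbb{C}^2/\Gamma])\cong\mathcal{M}_A(1,m)$ and $\mathrm{Quot}_I^{m_I}([\mathbb{C}^2/\Gamma])\cong\mathcal{M}_{A_I}(1,m_I)$, the morphism $\mathcal{M}_A(1,m)\to\mathcal{M}_{A_I}(1,m_I)$ induced via the universal property by the family $\overline e_I T=\bigoplus_{i\in\{\infty\}\cup I}T_i$ of $A_I$-modules, where $T$ is the tautological bundle on $\mathcal{M}_A(1,m)$ and $m_I$ is the restriction of $m$ to the indices in $I$; on closed points it is $M\mapsto\overline e_IM$. *)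

(* Defs.v *)
(* Schemes over F are represented by their functors of points on commutative
   F-algebras (Yoneda).  Modules are left modules, and paths of a quiver are
   composed from right to left. *)
From HB Require Import structures.
From mathcomp Require Import all_boot all_order all_algebra all_fingroup.
From mathcomp Require Import generic_quotient ring_quotient all_character.
From mathcomp Require Import boolp reals complex.
From mathcomp Require Import finmap mpoly monalg.

Set Implicit Arguments.
Unset Strict Implicit.
Unset Printing Implicit Defensive.

Import GRing.Theory.
Local Open Scope ring_scope.
Local Open Scope quotient_scope.

(* Associative unital F-algebras: rings with a central ring morphism from F.
   Unlike the library's algType, the zero algebra is allowed, so that quotients
   and corners need no side condition. *)
Record falgebra (F : fieldType) := FAlgebra {
  falg_ring :> pzRingType;
  falg_scal : {rmorphism F -> falg_ring};
  falg_central : forall c x, falg_scal c * x = x * falg_scal c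
}.

Section PathAlgebra.
Variables (F : fieldType) (V Arr : finType) (head tail : Arr -> V).

(* [(i, [:: a_1; ...; a_n])] is the path a_1 ... a_n with target i: it runs
   through a_n first. *)
Fixpoint is_path (i : V) (s : seq Arr) : bool :=
  if s is a :: s' then (head a == i) && is_path (tail a) s' else true.

Fixpoint path_source (i : V) (s : seq Arr) : V :=
  if s is a :: s' then path_source (tail a) s' else i.

Definition qpath := {p : V * seq Arr | is_path p.1 p.2}.

HB.instance Definition _ := Choice.on qpath.
HB.instance Definition _ := SubType.on qpath.

Definition path_alg := {malg F[qpath]}.

HB.instance Definition _ := GRing.Lmodule.on path_alg.

Definition idpath (i : V) : qpath := Sub (i, [::]) isT.

Definition path_comp (p q : qpath) : option qpath :=
  if path_source (val p).1 (val p).2 == (val q).1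
  then (insub ((val p).1, (val p).2 ++ (val q).2) : option qpath) else None.

Definition path_mul_basis (p q : qpath) : path_alg :=
  if path_comp p q is Some u then << u >> else 0.

Definition path_mul (x y : path_alg) : path_alg :=
  \sum_(p <- msupp x) \sum_(q <- msupp y)
    (mcoeff p x * mcoeff q y) *: path_mul_basis p q.

Definition path_one : path_alg := \sum_(i : V) << idpath i >>.

Let pcoefZ p c (x : path_alg) :
  mcoeff p (c *: x) = c * mcoeff p x.
Proof. exact: mcoeffZ. Qed.

Let lin (f : qpath -> path_alg) (x : path_alg) : path_alg :=
  \sum_(p <- msupp x) mcoeff p x *: f p.

Let linw (d : {fset qpath}) f (x : path_alg) :
  fsubset (msupp x) d ->
  lin f x = \sum_(p <- d) mcoeff p x *: f p.
Proof.
move=> le; rewrite /lin (big_fset_incl _ le) //= => p _ np.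
by rewrite mcoeff_outdom ?scale0r.
Qed.

Let linD f (c : F) x y : lin f (c *: x + y) = c *: lin f x + lin f y.
Proof.
pose d := fsetU (msupp x)
  (fsetU (msupp y) (msupp (c *: x + y))).
have s1 : fsubset (msupp x) d by exact: fsubsetUl.
have s2 : fsubset (msupp y) d.
  apply: fsubset_trans (fsubsetUr _ _).
  exact: fsubsetUl.
have s3 : fsubset (msupp (c *: x + y)) d.
  apply: fsubset_trans (fsubsetUr _ _).
  exact: fsubsetUr.
rewrite (linw f s1) (linw f s2) (linw f s3) scaler_sumr -big_split /=.
by apply: eq_bigr => p _; rewrite mcoeffD pcoefZ scalerDl scalerA.
Qed.

HB.instance Definition _ f :=
  GRing.isLinear.Build F path_alg path_alg *:%R (lin f) (linD f).

Let linU f p : lin f << p >> = f p.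
Proof.
rewrite /lin msuppU oner_eq0 big_seq_fset1 mcoeffU eqxx scale1r.
by [].
Qed.

Let lin_comp f g x : lin f (lin g x) = lin (fun p => lin f (g p)) x.
Proof. by rewrite {2}/lin linear_sum; apply: eq_bigr => p _; rewrite linearZ. Qed.

Let eq_lin f g : f =1 g -> lin f =1 lin g.
Proof. by move=> e x; apply: eq_bigr => p _; rewrite e. Qed.

Let lin_exch (h : qpath -> qpath -> path_alg) x y :
  lin (fun p => lin (h p) y) x = lin (fun q => lin (h^~ q) x) y.
Proof.
rewrite /lin; under eq_bigr do rewrite scaler_sumr.
rewrite exchange_big /=; apply: eq_bigr => q _.
rewrite scaler_sumr; apply: eq_bigr => p _.
by rewrite !scalerA mulrC.
Qed.

Let lin_id x : lin (fun p => << p >>) x = x.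
Proof.
rewrite {2}[x]monalgE; apply: eq_bigr => p _.
by apply/malgP => q; rewrite pcoefZ !mcoeffU mulr_natr.
Qed.

Let path_mulE x y :
  path_mul x y = lin (fun p => lin (path_mul_basis p) y) x.
Proof.
apply: eq_bigr => p _; rewrite scaler_sumr.
by apply: eq_bigr => q _; rewrite scalerA.
Qed.

Let path_mulEr x y :
  path_mul x y = lin (fun q => lin (path_mul_basis^~ q) x) y.
Proof. by rewrite path_mulE lin_exch. Qed.

Let path_source_cat i s t :
  path_source i (s ++ t) = path_source (path_source i s) t.
Proof. by elim: s i => //= a s IH i. Qed.

Let is_path_cat i s t :
  is_path i (s ++ t) = is_path i s && is_path (path_source i s) t.
Proof. by elim: s i => //= a s IH i; rewrite IH andbA. Qed.

Let path_compP (p q : qpath) :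
  if path_source (val p).1 (val p).2 == (val q).1 then
    exists2 u : qpath, path_comp p q = Some u &
      val u = ((val p).1, (val p).2 ++ (val q).2)
  else path_comp p q = None.
Proof.
rewrite /path_comp; case: eqP => // e.
case: insubP => [u _ eu|]; first by exists u.
by rewrite /= is_path_cat (valP p) e (valP q).
Qed.

Let basisA (p q u : qpath) :
  lin (path_mul_basis p) (path_mul_basis q u) =
  lin (path_mul_basis^~ u) (path_mul_basis p q).
Proof.
rewrite {2 4}/path_mul_basis.
have := path_compP q u; have := path_compP p q.
case: ifP => [/eqP e1 [v -> ev]|e1 ->].
  case: ifP => [/eqP e2 [w -> ew]|e2 ->].
    rewrite !linU /path_mul_basis.
    have := path_compP p w; have := path_compP v u.
    rewrite ev ew /= path_source_cat e1 e2 !eqxx => -[a -> ea] [b -> eb].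
    by congr << _ >>; apply: val_inj; apply: etrans eb _; rewrite catA -ea.
  rewrite linear0 linU /path_mul_basis.
  have := path_compP v u; rewrite ev /= path_source_cat e1 e2 => ->.
  by [].
case: ifP => [/eqP e2 [w -> ew]|e2 ->]; last by rewrite !linear0.
rewrite linear0 linU /path_mul_basis.
by have := path_compP p w; rewrite ew /= e1 => ->.
Qed.

Fact path_mulDl : left_distributive path_mul +%R.
Proof. by move=> x y z; rewrite !path_mulE linearD. Qed.

Fact path_mulDr : right_distributive path_mul +%R.
Proof. by move=> x y z; rewrite !path_mulEr linearD. Qed.

Fact path_mulA : associative path_mul.
Proof.
move=> x y z; rewrite [LHS]path_mulE [RHS]path_mulEr.
rewrite (eq_lin (g := fun p => lin (fun q => lin (fun u =>
  lin (path_mul_basis p) (path_mul_basis q u)) z) y)); last first.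
  move=> p; rewrite (path_mulE y) lin_comp; apply: eq_lin => q.
  by rewrite lin_comp.
rewrite [RHS](eq_lin (g := fun u => lin (fun p => lin (fun q =>
  lin (path_mul_basis^~ u) (path_mul_basis p q)) y) x)); last first.
  move=> u; rewrite (path_mulE x) lin_comp; apply: eq_lin => p.
  by rewrite lin_comp.
apply: etrans (lin_exch (fun p u => lin (fun q =>
  lin (path_mul_basis^~ u) (path_mul_basis p q)) y) x z).
apply: eq_lin => p.
apply: etrans (lin_exch (fun q u => lin (path_mul_basis p)
  (path_mul_basis q u)) y z) _.
by apply: eq_lin => u; apply: eq_lin => q; exact: basisA.
Qed.

Fact path_mul1 : left_id path_one path_mul.
Proof.
move=> x; rewrite path_mulEr -[RHS]lin_id; apply: eq_lin => q.
rewrite linear_sum (bigD1 (val q).1) //= linU big1 ?addr0 => [|i ne].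
  rewrite /path_mul_basis; have := path_compP (idpath (val q).1) q.
  rewrite /= eqxx => -[u -> eu]; congr << _ >>; apply: val_inj.
  exact: etrans eu (esym (surjective_pairing _)).
rewrite linU /path_mul_basis; have := path_compP (idpath i) q.
by rewrite /= (negPf ne) => ->.
Qed.

Fact path_mulr1 : right_id path_one path_mul.
Proof.
move=> x; rewrite path_mulE -[RHS]lin_id; apply: eq_lin => p.
rewrite linear_sum (bigD1 (path_source (val p).1 (val p).2)) //= linU.
rewrite big1 ?addr0 => [|i ne].
  rewrite /path_mul_basis.
  have := path_compP p (idpath (path_source (val p).1 (val p).2)).
  rewrite /= eqxx => -[u -> eu]; congr << _ >>; apply: val_inj.
  by apply: etrans eu _; rewrite cats0; apply: esym (surjective_pairing _).
rewrite linU /path_mul_basis; have := path_compP p (idpath i).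
by rewrite /= eq_sym (negPf ne) => ->.
Qed.

HB.instance Definition _ := GRing.Zmodule_isPzRing.Build path_alg
  path_mulA path_mul1 path_mulr1 path_mulDl path_mulDr.

Fact path_scaleAl (c : F) (x y : path_alg) : c *: (x * y) = (c *: x) * y.
Proof.
apply/esym/(etrans (path_mulE (c *: x) y)); rewrite linearZ.
by congr (_ *: _); apply/esym/path_mulE.
Qed.

Fact path_scaleAr (c : F) (x y : path_alg) : c *: (x * y) = x * (c *: y).
Proof.
apply/esym/(etrans (path_mulEr x (c *: y))); rewrite linearZ.
by congr (_ *: _); apply/esym/path_mulEr.
Qed.

Definition path_scal (c : F) : path_alg := c *: (1 : path_alg).

Fact path_scal_zmod : zmod_morphism path_scal.
Proof. by move=> c d; rewrite /path_scal scalerBl. Qed.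

Fact path_scal_monoid : monoid_morphism path_scal.
Proof.
split; first exact: scale1r.
by move=> c d; rewrite /path_scal -path_scaleAl mul1r scalerA.
Qed.

HB.instance Definition _ :=
  GRing.isZmodMorphism.Build F path_alg path_scal path_scal_zmod.
HB.instance Definition _ :=
  GRing.isMonoidMorphism.Build F path_alg path_scal path_scal_monoid.

Fact path_scal_central c x : path_scal c * x = x * path_scal c.
Proof.
by rewrite /path_scal -path_scaleAl -path_scaleAr mul1r mulr1.
Qed.

Definition path_algebra : falgebra F := FAlgebra path_scal_central.

Definition pvertex (i : V) : path_algebra := << idpath i >> : path_alg.

Fact parrow_subproof (a : Arr) : is_path (head a) [:: a].
Proof. by rewrite /= eqxx. Qed.

Definition parrow (a : Arr) : path_algebra :=
  << (Sub (head a, [:: a]) (parrow_subproof a) : qpath) >> : path_alg.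

Fact pvertex_mul i j :
  pvertex i * pvertex j = if i == j then pvertex i else 0.
Proof.
apply: (etrans (path_mulE _ _)); rewrite !linU /path_mul_basis.
have := path_compP (idpath i) (idpath j).
case: eqP => /= [e|_ -> //]; first subst j; rewrite ?eqxx => -[u -> eu].
by congr << _ >>; apply: val_inj.
Qed.

Fact pvertex_sum : \sum_i pvertex i = 1.
Proof. by []. Qed.

End PathAlgebra.

Section Quotient.
Variables (F : fieldType) (B : falgebra F) (S : B -> Prop).

Inductive ideal_gen : B -> Prop :=
| IdealIn x of S x : ideal_gen x
| Ideal0 : ideal_gen 0
| IdealD x y of ideal_gen x & ideal_gen y : ideal_gen (x + y)
| IdealMl b x of ideal_gen x : ideal_gen (b * x)
| IdealMr b x of ideal_gen x : ideal_gen (x * b).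

Definition ideal_pred : {pred B} := [pred x | `[< ideal_gen x >]].

Fact ideal_zmod_closed : zmod_closed ideal_pred.
Proof.
split=> [|x y /asboolP Ix /asboolP Iy]; apply/asboolP; first exact: Ideal0.
by apply: IdealD => //; rewrite -mulN1r; apply: IdealMl.
Qed.

HB.instance Definition _ :=
  GRing.isZmodClosed.Build B ideal_pred ideal_zmod_closed.

Definition quot_alg := Quotient.quot ideal_pred.

HB.instance Definition _ := GRing.Zmodule.on quot_alg.

Definition quot_pi (x : B) : quot_alg := \pi x.

Let piP x y : (quot_pi x = quot_pi y) <-> ideal_gen (x - y).
Proof.
rewrite /quot_pi; split=> [/eqP|I]; first by rewrite -Quotient.idealrBE => /asboolP.
by apply/eqP; rewrite -Quotient.idealrBE; apply/asboolP.
Qed.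

Let piK (u : quot_alg) : quot_pi (repr u) = u.
Proof. exact: reprK. Qed.

Fact quot_pi_zmod : zmod_morphism quot_pi.
Proof. by move=> x y; rewrite /quot_pi !piE. Qed.

Let piB := quot_pi_zmod.
Let piD x y : quot_pi (x + y) = quot_pi x + quot_pi y.
Proof. by rewrite /quot_pi !piE. Qed.

Definition quot_mul (u v : quot_alg) : quot_alg := quot_pi (repr u * repr v).

Let pi_mul x y : quot_mul (quot_pi x) (quot_pi y) = quot_pi (x * y).
Proof.
apply/piP; set x' := repr _; set y' := repr _.
have Ix : ideal_gen (x' - x) by apply/piP; rewrite piK.
have Iy : ideal_gen (y' - y) by apply/piP; rewrite piK.
have -> : x' * y' - x * y = (x' - x) * y' + x * (y' - y).
  by rewrite mulrBl mulrBr addrA subrK.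
by apply: IdealD; [apply: IdealMr | apply: IdealMl].
Qed.

Let pi_ind (P : quot_alg -> Prop) : (forall x, P (quot_pi x)) -> forall u, P u.
Proof. by move=> h u; rewrite -(piK u). Qed.

Fact quot_mulA : associative quot_mul.
Proof.
elim/pi_ind=> x; elim/pi_ind=> y; elim/pi_ind=> z.
by rewrite !pi_mul mulrA.
Qed.

Fact quot_mul1 : left_id (quot_pi 1) quot_mul.
Proof. by elim/pi_ind=> x; rewrite pi_mul mul1r. Qed.

Fact quot_mulr1 : right_id (quot_pi 1) quot_mul.
Proof. by elim/pi_ind=> x; rewrite pi_mul mulr1. Qed.

Fact quot_mulDl : left_distributive quot_mul +%R.
Proof.
elim/pi_ind=> x; elim/pi_ind=> y; elim/pi_ind=> z.
by rewrite -piD !pi_mul mulrDl piD.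
Qed.

Fact quot_mulDr : right_distributive quot_mul +%R.
Proof.
elim/pi_ind=> x; elim/pi_ind=> y; elim/pi_ind=> z.
by rewrite -piD !pi_mul mulrDr piD.
Qed.

HB.instance Definition _ := GRing.Zmodule_isPzRing.Build quot_alg
  quot_mulA quot_mul1 quot_mulr1 quot_mulDl quot_mulDr.

Fact quot_pi_monoid : monoid_morphism quot_pi.
Proof. by split=> // x y; rewrite -pi_mul. Qed.

HB.instance Definition _ :=
  GRing.isZmodMorphism.Build B quot_alg quot_pi quot_pi_zmod.
HB.instance Definition _ :=
  GRing.isMonoidMorphism.Build B quot_alg quot_pi quot_pi_monoid.

Fact quot_central c u :
  (quot_pi \o @falg_scal F B) c * u = u * (quot_pi \o @falg_scal F B) c.
Proof. by elim/pi_ind: u => x; rewrite /= -!rmorphM falg_central. Qed.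

Definition quot_algebra : falgebra F :=
  @FAlgebra F quot_alg (quot_pi \o @falg_scal F B) quot_central.

Definition quot_proj : B -> quot_algebra := quot_pi.

End Quotient.

Fact orthogonal_idem (B : pzRingType) (J : finType) (e : option J -> B)
    (P : {set J}) :
  (forall i j, e i * e j = if i == j then e i else 0) ->
  (e None + \sum_(i in P) e (Some i)) * (e None + \sum_(i in P) e (Some i)) =
  e None + \sum_(i in P) e (Some i).
Proof.
move=> eM; set s := \sum_(i in P) _.
have es : e None * s = 0 by rewrite mulr_sumr big1 // => i _; rewrite eM.
have se : s * e None = 0 by rewrite mulr_suml big1 // => i _; rewrite eM.
rewrite mulrDl !mulrDr eM eqxx es se addr0 add0r; congr (_ + _).
rewrite {1}/s mulr_suml; apply: eq_bigr => i Pi.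
rewrite mulr_sumr (bigD1 i) //= eM eqxx big1 ?addr0 // => j /andP[_ ne].
by rewrite eM; case: eqP => // -[e1]; rewrite e1 eqxx in ne.
Qed.

Section Corner.
Variables (F : fieldType) (B : falgebra F) (e : B) (ee : e * e = e).

(* eBe, with unit e *)
Definition corner_pred : {pred B} := [pred x | e * x * e == x].

Fact corner_zmod_closed : zmod_closed corner_pred.
Proof.
split=> [|x y /eqP ex /eqP ey]; rewrite !inE; first by rewrite mulr0 mul0r.
by rewrite mulrBr mulrBl ex ey.
Qed.

HB.instance Definition _ :=
  GRing.isZmodClosed.Build B corner_pred corner_zmod_closed.

Record corner_alg := Corner { corner_val : B; _ : corner_val \in corner_pred }.

HB.instance Definition _ := [isSub for corner_val].
HB.instance Definition _ := [Choice of corner_alg by <:].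
HB.instance Definition _ := [SubChoice_isSubZmodule of corner_alg by <:].

Let corner_l (x : corner_alg) : e * val x = val x.
Proof. by have /eqP <- := valP x; rewrite !mulrA ee. Qed.
Let corner_r (x : corner_alg) : val x * e = val x.
Proof. by have /eqP <- := valP x; rewrite -!mulrA ee. Qed.

Fact corner_one_subproof : e \in corner_pred.
Proof. by rewrite inE !ee. Qed.

Fact corner_mul_subproof (x y : corner_alg) : val x * val y \in corner_pred.
Proof. by rewrite inE mulrA corner_l -mulrA corner_r. Qed.

Fact corner_compress_subproof (x : B) : e * x * e \in corner_pred.
Proof. by rewrite inE !mulrA ee -!mulrA ee. Qed.

Definition corner_one : corner_alg := Corner corner_one_subproof.
Definition corner_mul (x y : corner_alg) : corner_alg :=
  Corner (corner_mul_subproof x y).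
Definition corner_compress (x : B) : corner_alg :=
  Corner (corner_compress_subproof x).

Fact corner_mulA : associative corner_mul.
Proof. by move=> x y z; apply: val_inj; rewrite /= mulrA. Qed.
Fact corner_mul1 : left_id corner_one corner_mul.
Proof. by move=> x; apply: val_inj; exact: corner_l. Qed.
Fact corner_mulr1 : right_id corner_one corner_mul.
Proof. by move=> x; apply: val_inj; exact: corner_r. Qed.
Fact corner_mulDl : left_distributive corner_mul +%R.
Proof. by move=> x y z; apply: val_inj; exact: mulrDl. Qed.
Fact corner_mulDr : right_distributive corner_mul +%R.
Proof. by move=> x y z; apply: val_inj; exact: mulrDr. Qed.

HB.instance Definition _ := GRing.Zmodule_isPzRing.Build corner_alg
  corner_mulA corner_mul1 corner_mulr1 corner_mulDl corner_mulDr.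

Definition corner_scal (c : F) : corner_alg := corner_compress (falg_scal B c).

Let corner_scalE c : val (corner_scal c) = falg_scal B c * e.
Proof. by rewrite /= -falg_central -mulrA ee. Qed.

Fact corner_scal_zmod : zmod_morphism corner_scal.
Proof.
move=> c d; apply: val_inj; rewrite corner_scalE rmorphB mulrBl -!corner_scalE.
by [].
Qed.

Fact corner_scal_monoid : monoid_morphism corner_scal.
Proof.
split=> [|c d]; apply: val_inj; first by rewrite corner_scalE rmorph1 mul1r.
rewrite corner_scalE; apply/esym.
change (val (corner_scal c) * val (corner_scal d) = falg_scal B (c * d) * e).
by rewrite !corner_scalE rmorphM mulrA -(mulrA _ e) -falg_central mulrA -mulrA ee.
Qed.

HB.instance Definition _ :=
  GRing.isZmodMorphism.Build F corner_alg corner_scal corner_scal_zmod.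
HB.instance Definition _ :=
  GRing.isMonoidMorphism.Build F corner_alg corner_scal corner_scal_monoid.

Fact corner_central c x : corner_scal c * x = x * corner_scal c.
Proof.
apply: val_inj.
change (val (corner_scal c) * val x = val x * val (corner_scal c)).
by rewrite corner_scalE -mulrA corner_l mulrA -falg_central -mulrA corner_r.
Qed.

Definition corner_algebra : falgebra F := FAlgebra corner_central.

End Corner.

Section Modules.
Variables (F : fieldType) (B : falgebra F).

(* A left module over B (x)_F R. *)
Record bmodule (R : comAlgType F) := BModule {
  bmod_car :> lmodType R;
  bact : B -> bmod_car -> bmod_car;
  bact_linear : forall b, linear (bact b);
  bactD : forall b c x, bact (b + c) x = bact b x + bact c x;
  bactM : forall b c x, bact (b * c) x = bact b (bact c x);
  bact1 : forall x, bact 1 x = x;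
  bact_scal : forall (k : F) x, bact (falg_scal B k) x = (k%:A : R) *: x
}.

Definition bmod_iso (R : comAlgType F) (E E' : bmodule R) : Prop :=
  exists f : E -> E',
    [/\ linear f, bijective f & forall b x, f (bact b x) = bact b (f x)].

(* u : M -> M' exhibits M' as the extension of scalars of M along phi. *)
Definition is_base_change (R S : comAlgType F) (phi : {lrmorphism R -> S})
    (M : lmodType R) (M' : lmodType S) (u : M -> M') : Prop :=
  linear_for (phi \; *:%R) u /\
  (forall (N : lmodType S) (v : M -> N), linear_for (phi \; *:%R) v ->
    exists! w : M' -> N, linear w /\ forall x, w (u x) = v x).

Definition is_pullback (R S : comAlgType F) (phi : {lrmorphism R -> S})
    (E : bmodule R) (E' : bmodule S) : Prop :=
  exists u : E -> E',
    is_base_change phi u /\ forall b x, u (bact b x) = bact b (u x).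

End Modules.

Section CornerModule.
Variables (F : fieldType) (B : falgebra F) (e : B) (ee : e * e = e).
Variables (R : comAlgType F) (E : bmodule B R).

(* eE, as a module over eBe *)
Definition corner_mod_pred : {pred E} := [pred x | bact e x == x].

Fact corner_mod_closed : subsemimod_closed corner_mod_pred.
Proof.
have z : bact e (0 : E) = 0.
by have := @bact_linear _ _ _ E e (-1) 0 0; rewrite addr0 scaler0 scaleN1r addNr.
split; first split=> [|x y /eqP ex /eqP ey]; rewrite ?inE ?z //.
  by have := @bact_linear _ _ _ E e 1 x y; rewrite !scale1r ex ey => ->.
move=> c x /eqP ex; rewrite inE.
by have := @bact_linear _ _ _ E e c x 0; rewrite !addr0 z addr0 ex => ->.
Qed.

HB.instance Definition _ :=
  GRing.isSubmodClosed.Build R E corner_mod_pred corner_mod_closed.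

Record corner_mod_car := CornerMod {
  corner_mod_val : E; _ : corner_mod_val \in corner_mod_pred }.

HB.instance Definition _ := [isSub for corner_mod_val].
HB.instance Definition _ := [Choice of corner_mod_car by <:].
HB.instance Definition _ := [SubChoice_isSubLmodule of corner_mod_car by <:].

Fact corner_act_subproof (b : corner_alg e) (x : corner_mod_car) :
  bact (val b) (val x) \in corner_mod_pred.
Proof.
rewrite inE -bactM; have /eqP <- := valP b.
by rewrite !mulrA ee.
Qed.

Definition corner_act (b : corner_alg e) (x : corner_mod_car) : corner_mod_car :=
  CornerMod (corner_act_subproof b x).

Fact corner_act_linear b : linear (corner_act b).
Proof. by move=> c x y; apply: val_inj; exact: bact_linear. Qed.
Fact corner_actD b c x :
  corner_act (b + c) x = corner_act b x + corner_act c x.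
Proof. by apply: val_inj; exact: bactD. Qed.
Fact corner_actM b c x :
  corner_act ((b : corner_algebra ee) * c) x = corner_act b (corner_act c x).
Proof. by apply: val_inj; exact: bactM. Qed.
Fact corner_act1 x : corner_act (1 : corner_algebra ee) x = x.
Proof. by apply: val_inj; apply/eqP; exact: valP x. Qed.
Fact corner_act_scal (k : F) x :
  corner_act (falg_scal (corner_algebra ee) k) x = (k%:A : R) *: x.
Proof.
apply: val_inj; rewrite /= -bact_scal.
have /eqP ex := valP x.
by rewrite !bactM ex -[in LHS]bactM -falg_central bactM ex.
Qed.

Definition corner_module : bmodule (corner_algebra ee) R :=
  @BModule F (corner_algebra ee) R corner_mod_car corner_act corner_act_linear
    corner_actD corner_actM corner_act1 corner_act_scal.

End CornerModule.

Section Functors.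
Variable F : fieldType.

(* A functor from commutative F-algebras to sets.  The algebras of the library
   are nonzero; the zero algebra, at which every scheme has exactly one point,
   is left out. *)
Record cfunctor := CFunctor {
  pts :> comAlgType F -> Type;
  pmap : forall R S : comAlgType F, {lrmorphism R -> S} -> pts R -> pts S;
  pmap_id : forall (R : comAlgType F) (phi : {lrmorphism R -> R}),
    phi =1 id -> pmap phi =1 id;
  pmap_comp : forall (R S T : comAlgType F) (phi : {lrmorphism R -> S})
    (psi : {lrmorphism S -> T}) (chi : {lrmorphism R -> T}),
    chi =1 psi \o phi -> pmap chi =1 pmap psi \o pmap phi
}.

Record cmorphism (X Y : cfunctor) := CMorphism {
  cmor :> forall R : comAlgType F, X R -> Y R;
  cmor_natural : forall (R S : comAlgType F) (phi : {lrmorphism R -> S}) x,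
    cmor (pmap phi x) = pmap phi (cmor x)
}.

Definition is_ciso (X Y : cfunctor) (f : cmorphism X Y) : Prop :=
  forall R, bijective (@f R).

Fact ccomp_natural (X Y Z : cfunctor) (g : cmorphism Y Z) (f : cmorphism X Y)
    (R S : comAlgType F) (phi : {lrmorphism R -> S}) x :
  g S (f S (pmap phi x)) = pmap phi (g R (f R x)).
Proof. by rewrite !cmor_natural. Qed.

Definition ccomp (X Y Z : cfunctor) (g : cmorphism Y Z) (f : cmorphism X Y) :
  cmorphism X Z := CMorphism (ccomp_natural g f).

Section Product.
Variables (J : Type) (Y : J -> cfunctor).

Definition cprod_map (R S : comAlgType F) (phi : {lrmorphism R -> S})
  (y : forall j, Y j R) : forall j, Y j S := fun j => pmap phi (y j).

Fact cprod_id (R : comAlgType F) (phi : {lrmorphism R -> R}) :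
  phi =1 id -> cprod_map phi =1 id.
Proof.
move=> e y; apply: functional_extensionality_dep => j.
exact: (pmap_id e (y j)).
Qed.

Fact cprod_comp (R S T : comAlgType F) (phi : {lrmorphism R -> S})
    (psi : {lrmorphism S -> T}) (chi : {lrmorphism R -> T}) :
  chi =1 psi \o phi -> cprod_map chi =1 cprod_map psi \o cprod_map phi.
Proof.
move=> e y; apply: functional_extensionality_dep => j.
exact: (pmap_comp e (y j)).
Qed.

Definition cprod : cfunctor := CFunctor cprod_id cprod_comp.

Variables (X : cfunctor) (f : forall j, cmorphism X (Y j)).

Fact cprod_mor_natural (R S : comAlgType F) (phi : {lrmorphism R -> S}) x :
  (fun j => f j S (pmap phi x)) = cprod_map phi (fun j => f j R x).
Proof.
by apply: functional_extensionality_dep => j; rewrite cmor_natural.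
Qed.

Definition cprod_mor : cmorphism X cprod :=
  @CMorphism X cprod (fun R x j => f j R x) cprod_mor_natural.

End Product.

Definition is_ideal (R : comAlgType F) (J : R -> Prop) : Prop :=
  [/\ J 0, forall a b, J a -> J b -> J (a + b) & forall a b, J b -> J (a * b)].

(* For every y : Spec R -> Y, the base change of f along y is isomorphic, over
   Spec R, to Spec R/J -> Spec R for some ideal J of R.  The points of
   X x_Y Spec R over phi : R -> S are the x in X(S) lying over y; Spec R/J has
   one point over phi if phi kills J, and none otherwise. *)
Definition closed_immersion (X Y : cfunctor) (f : cmorphism X Y) : Prop :=
  forall (R : comAlgType F) (y : Y R), exists J : R -> Prop,
    is_ideal J /\
    (forall (S : comAlgType F) (phi : {lrmorphism R -> S}),
      ((exists x : X S, f S x = pmap phi y) <-> (forall a, J a -> phi a = 0)) /\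
      (forall x x' : X S,
        f S x = pmap phi y -> f S x' = pmap phi y -> x = x')).

Definition is_field (K : comAlgType F) : Prop :=
  forall x : K, x != 0 -> exists y : K, x * y = 1.

End Functors.

(* P, a submodule of T, is free of rank n. *)
Definition free_rank (R : nzRingType) (T : lmodType R) (P : T -> Prop)
    (n : nat) : Prop :=
  exists b : 'I_n -> T, (forall i, P (b i)) /\
    (forall x, P x -> exists! c : 'rV[R]_n, x = \sum_i c 0 i *: b i).

(* finitely generated projective: a direct summand of some R^N *)
Definition fg_projective (R : nzRingType) (T : lmodType R) : Prop :=
  exists (N : nat) (s : {linear T -> 'rV[R]_N}) (p : {linear 'rV[R]_N -> T}),
    cancel s p.

Section Moduli.
(* B comes with idempotents e_j for the vertices j in {oo} + W (None is the
   framing vertex oo), and the dimension vector is (1, m). *)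
Variables (F : fieldType) (B : falgebra F) (W : finType).
Variables (e : option W -> B) (m : W -> nat).

Definition vertex_part (R : comAlgType F) (E : bmodule B R) (j : option W) :
  E -> Prop := fun x => bact (e j) x = x.

Definition eta (j : option W) : int :=
  if j is Some _ then 1 else - (\sum_(i : W) m i)%:Z.

Definition is_submodule (K : comAlgType F) (E : bmodule B K) (N : E -> Prop) :
    Prop :=
  [/\ N 0, forall c x y, N x -> N y -> N (c *: x + y)
    & forall b x, N x -> N (bact b x)].

Definition stable (K : comAlgType F) (E : bmodule B K) : Prop :=
  forall N : E -> Prop, is_submodule N ->
    (exists2 x, N x & x != 0) -> (exists x, ~ N x) ->
    forall d : option W -> nat,
      (forall j, free_rank (fun x => N x /\ vertex_part j x) (d j)) ->
      0 < \sum_j eta j * (d j)%:Z.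

(* Flat families over Spec R of stable modules of dimension vector (1, m),
   normalised by T_oo being trivial.  Vector bundles on Spec R are finitely
   generated projective modules; ranks and stability are tested on the fibres
   over all Spec K -> Spec R, with K a field. *)
Definition stable_family (R : comAlgType F) (E : bmodule B R) : Prop :=
  [/\ fg_projective E,
      free_rank (@vertex_part R E None) 1
    & forall (K : comAlgType F) (phi : {lrmorphism R -> K}) (E' : bmodule B K),
        is_field K -> is_pullback phi E E' ->
        (forall i, free_rank (@vertex_part K E' (Some i)) (m i)) /\ stable E'].

(* X is the fine moduli space, with tautological family taut. *)
Record fine_moduli (X : cfunctor F) := FineModuli {
  taut : forall R : comAlgType F, X R -> bmodule B R;
  taut_stable : forall R x, stable_family (@taut R x);
  taut_natural : forall (R S : comAlgType F) (phi : {lrmorphism R -> S}) x,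
    is_pullback phi (taut x) (taut (pmap phi x));
  taut_universal : forall (R : comAlgType F) (E : bmodule B R),
    stable_family E -> exists! x : X R, bmod_iso E (taut x)
}.

End Moduli.

Section McKay.
Variables (F : fieldType) (gT : finGroupType) (G : {group gT}) (r : nat).
Variables (d : 'I_r.+1 -> nat).
Variables (rho : forall i, mx_representation F G (d i)).
Variable V : mx_representation F G 2.

(* rho lists the irreducible representations, starting with the trivial one. *)
Definition irreducibles : Prop :=
  [/\ d ord0 = 1%N /\ (forall g, g \in G -> rho ord0 g = 1%:M),
      forall i, mx_irreducible (rho i),
      forall i j, mx_rsim (rho i) (rho j) -> i = j
    & forall n (sigma : mx_representation F G n), mx_irreducible sigma ->
        exists i, mx_rsim sigma (rho i)].

(* dim Hom_G(s, t); a representation acts on column vectors. *)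
Definition hom_dim n1 n2 (s : mx_representation F G n1)
    (t : mx_representation F G n2) : nat :=
  \dim (\bigcap_(g in G)
    lker (linfun (fun f : 'M[F]_(n2, n1) => t g *m f - f *m s g)))%VS.

Definition mckay_mult (i j : 'I_r.+1) : nat :=
  hom_dim (rho j) (prod_repr (rho i) V).

(* Edges of the framed McKay graph: None is the framing edge, and an edge of
   the McKay graph joining i <= j is given by (i, j) and an index below the
   number of such edges. *)
Definition mckay_edge :=
  {p : 'I_r.+1 * 'I_r.+1 & 'I_(if (p.1 <= p.2)%N then mckay_mult p.1 p.2 else 0%N)}.

Definition framed_edge := option mckay_edge.

(* None is the vertex oo. *)
Definition framed_vertex := option 'I_r.+1.

Definition edge_ends (u : framed_edge) : framed_vertex * framed_vertex :=
  if u is Some v then (Some (tag v).1, Some (tag v).2) else (None, Some ord0).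

Definition arrow := (framed_edge * bool)%type.

Definition arr_tail (a : arrow) : framed_vertex :=
  if a.2 then (edge_ends a.1).1 else (edge_ends a.1).2.
Definition arr_head (a : arrow) : framed_vertex :=
  if a.2 then (edge_ends a.1).2 else (edge_ends a.1).1.
Definition opp_arrow (a : arrow) : arrow := (a.1, ~~ a.2).

(* the arrow b^* from 0 to oo *)
Definition bstar : arrow := (None, false).

Variable eps : arrow -> bool.

Definition framed_path_algebra := path_algebra F arr_head arr_tail.

Definition preprojective_relation (x : framed_path_algebra) : Prop :=
  exists i : framed_vertex,
    x = \sum_(a : arrow | arr_head a == i)
          falg_scal framed_path_algebra ((-1) ^+ eps a)
            * (parrow F arr_head arr_tail a * parrow F arr_head arr_tail (opp_arrow a)).

Definition Pi_alg := quot_algebra preprojective_relation.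

Definition pi_Pi : framed_path_algebra -> Pi_alg :=
  @quot_proj F framed_path_algebra preprojective_relation.

Definition A_alg :=
  quot_algebra (fun x : Pi_alg => x = pi_Pi (parrow F arr_head arr_tail bstar)).

Definition pi_A : Pi_alg -> A_alg := @quot_proj F Pi_alg _.

Definition evert (i : framed_vertex) : A_alg :=
  pi_A (pi_Pi (pvertex F arr_head arr_tail i)).

Variable I : {set 'I_r.+1}.

Definition ebar : A_alg := evert None + \sum_(i in I) evert (Some i).

Let evertM i j : evert i * evert j = if i == j then evert i else 0.
Proof.
apply: (etrans (esym (rmorphM (quot_pi _) _ _))).
apply: (etrans (congr1 _ (esym (rmorphM (quot_pi _) _ _)))).
rewrite pvertex_mul; case: ifP => _ //.
exact: (etrans (congr1 _ (rmorph0 (quot_pi _))) (rmorph0 (quot_pi _))).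
Qed.

Fact ebar_idem : ebar * ebar = ebar.
Proof. exact: orthogonal_idem evertM. Qed.

Definition A_I_alg : falgebra F := corner_algebra ebar_idem.

(* e_j, as the element ebar e_j ebar of A_I, for j in {oo} + I *)
Definition evert_I (j : option {i | i \in I}) : A_I_alg :=
  corner_compress ebar_idem (evert (omap val j)).

Definition dim_restrict (n : 'I_r.+1 -> nat) (i : {i | i \in I}) : nat := n (val i).

(* f is the morphism of moduli spaces induced by the family ebar T. *)
Definition is_cornering (n : 'I_r.+1 -> nat) (X Y : cfunctor F)
    (uX : fine_moduli evert n X)
    (uY : fine_moduli evert_I (dim_restrict n) Y)
    (f : cmorphism X Y) : Prop :=
  forall (R : comAlgType F) (x : X R),
    bmod_iso (corner_module ebar_idem (taut uX x)) (taut uY (f R x)).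

End McKay.

(* the polynomial ring R[x, y]; the notation {mpoly R[2]} of mpoly is shadowed
   here by that of monalg *)
Local Notation mpoly2 R := (mpoly.mpoly 2 R).

Section Hilb.
Variables (F : fieldType) (gT : finGroupType) (G : {group gT}) (r : nat).
Variables (d : 'I_r.+1 -> nat).
Variables (rho : forall i, mx_representation F G (d i)).
Variable V : mx_representation F G 2.
Variable n : 'I_r.+1 -> nat.

(* (g f)(v) = f(g^-1 v) *)
Definition gact (R : comAlgType F) (g : gT) (f : mpoly2 R) : mpoly2 R :=
  f \mPo [tuple \sum_(j < 2) ((V g^-1%g i j)%:A : R) *: 'X_j | i < 2].

Definition mpoly_ideal (R : comAlgType F) (J : mpoly2 R -> Prop) : Prop :=
  [/\ J 0, forall f g, J f -> J g -> J (f + g) & forall f g, J g -> J (f * g)].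

(* The ideal generated by the image of J; it is the least one containing it. *)
Definition mpoly_pullback (R S : comAlgType F) (phi : {lrmorphism R -> S})
    (J : mpoly2 R -> Prop) : mpoly2 S -> Prop :=
  fun f => forall J' : mpoly2 S -> Prop, mpoly_ideal J' ->
    (forall g, J g -> J' (map_mpoly phi g)) -> J' f.

(* K[x,y]/J is isomorphic to the direct sum of the rho_i^(n_i), where n_i copies
   of rho_i are realised as the columns of d_i x n_i matrices: psi is a
   G-equivariant linear surjection from K[x,y] with kernel J. *)
Definition isotypic_type (K : comAlgType F) (J : mpoly2 K -> Prop) : Prop :=
  exists psi : forall i, {linear mpoly2 K -> 'M[K]_(d i, n i)},
    [/\ forall f, J f <-> (forall i, psi i f = 0),
        forall t : (forall i, 'M[K]_(d i, n i)), exists f, forall i, psi i f = t i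
      & forall g f i, g \in G ->
          psi i (gact g f) = map_mx (in_alg K) (rho i g) *m psi i f].

(* The R-points: G-stable ideals J with R[x,y]/J finitely generated projective
   (p composed with the projection onto R[x,y]/J is split by s) whose fibres
   over all field-valued points have the prescribed isotypic type. *)
Definition hilb_ideal (R : comAlgType F) (J : mpoly2 R -> Prop) : Prop :=
  [/\ mpoly_ideal J,
      forall g f, g \in G -> J f -> J (gact g f),
      exists (N : nat) (s : {linear mpoly2 R -> 'rV[R]_N})
        (p : {linear 'rV[R]_N -> mpoly2 R}),
        (forall f, J f -> s f = 0) /\ (forall f, J (f - p (s f)))
    & forall (K : comAlgType F) (phi : {lrmorphism R -> K}),
        is_field K -> isotypic_type (mpoly_pullback phi J)].

(* H is Hilb^n([V/G]), with universal family of ideals huniv. *)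
Record hilb_scheme (H : cfunctor F) := HilbScheme {
  huniv : forall R : comAlgType F, H R -> mpoly2 R -> Prop;
  huniv_hilb : forall R x, hilb_ideal (@huniv R x);
  huniv_natural : forall (R S : comAlgType F) (phi : {lrmorphism R -> S}) x f,
    huniv (pmap phi x) f <-> mpoly_pullback phi (huniv x) f;
  huniv_universal : forall (R : comAlgType F) (J : mpoly2 R -> Prop),
    hilb_ideal J -> exists! x : H R, forall f, J f <-> huniv x f
}.

End Hilb.

(* Main.v *)
(* A stable A-module of dimension vector (1, n) is generated by its framing
   vertex, and by Nakayama the same holds for flat families; so a family is
   determined by the annihilator of a generator v of its framing part.  Since
   the subsets I_k cover all vertices, this annihilator is determined by those
   of the corners e_(I_k) v, whence injectivity on points over any base.

   Conversely, let E_k be families of A_(I_k)-modules over R, generated by v_k.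
   They glue to a family of A-modules iff, for all k and k', every vertex i of
   I_k and every b in A, the elements z of e_i A e_oo (x) R killing v_k are such
   that b z kills v_k'.  As E_k' is a direct summand of a free module, this is
   the vanishing of a set of elements of R, hence a closed condition; after a
   base change R -> S it need only be checked on elements coming from R. *)
Require Import Defs.
From HB Require Import structures.
From mathcomp Require Import all_boot all_order all_algebra all_fingroup.
From mathcomp Require Import generic_quotient ring_quotient all_character.
From mathcomp Require Import boolp reals complex.
From mathcomp Require classical_sets.

Set Implicit Arguments.
Unset Strict Implicit.
Unset Printing Implicit Defensive.

Import Order.TTheory GRing.Theory Num.Theory.
Local Open Scope ring_scope.

(** * Residue fields *)

(** The obstacle is that an element of A (x) S killing v_k need not come from A (x) R, since S is an
    arbitrary R-algebra. The splitting of E_k off a free module resolves this. It provides finitely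
    many fixed elements such that every a in A differs from an R-combination of them by a relation
    over R that kills v_k. The gluing condition is necessary at every point of the moduli space over
    y, so the coordinates of b e_i times these relations, applied to v_k', vanish at all such
    points. Once they vanish in S, the vector b e_i a v_k' is an S-linear function of the
    coordinates of a v_k, and the condition follows for all of A (x) S. The glued module is the
    submodule generated by (v_k) in the direct sum of the E_k. It is projective because assigning
    every vertex to one corner containing it defines a retraction onto this submodule. No tensor
    product is formed: elements of A (x) R are lists of pairs, and base change is handled by its
    universal property together with dual bases. *)

Section ResidueField.
Variables (F : fieldType) (R : comAlgType F).

Lemma exists_maximal_ideal (J : R -> Prop) : is_ideal J -> ~ J 1 ->
  exists m : R -> Prop,
    [/\ is_ideal m, ~ m 1, forall a, J a -> m a
      & forall a, ~ m a -> exists b c, m c /\ a * b + c = 1].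
Proof.
move=> idJ J1.
pose proper_over (I : R -> Prop) := [/\ is_ideal I, ~ I 1 & forall a, J a -> I a].
pose T := {I : R -> Prop | proper_over I}.
pose le (s t : T) := `[< forall a, sval s a -> sval t a >].
have [||||[m m_over] max_m] := @classical_sets.Zorn T le.
- by move=> t; apply/asboolP.
- move=> s t u /asboolP st /asboolP tu; apply/asboolP => a /st; exact: tu.
- move=> [s hs] [t ht] /asboolP /= st /asboolP /= ts.
  by apply/eq_exist; apply: funext => a; apply: propext; split; [apply: st|apply: ts].
(* The disjunct [J a] provides an upper bound for the empty chain as well. *)
- move=> A totA; pose U a := J a \/ exists2 s : T, A s & sval s a.
  have U_over : proper_over U.
    split; first split.
    + by left; case: idJ.
    + move=> a b [Ja|[s As sa]] [Jb|[t At tb]].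
      * by left; case: idJ => _ + _; apply.
      * by right; exists t => //; case: (svalP t) => -[_ + _ _ Jt]; apply=> //; apply: Jt.
      * by right; exists s => //; case: (svalP s) => -[_ + _ _ Js]; apply=> //; apply: Js.
      * right; case: (totA s t As At) => /asboolP le_st.
          by exists t => //; case: (svalP t) => -[_ + _ _ _]; apply=> //; apply: le_st.
        by exists s => //; case: (svalP s) => -[_ + _ _ _]; apply=> //; apply: le_st.
    + move=> a b [Jb|[s As sb]]; first by left; case: idJ => _ _; apply.
      by right; exists s => //; case: (svalP s) => -[_ _ + _ _]; apply.
    + by case=> // -[s As]; case: (svalP s).
    + by move=> a Ja; left.
  exists (exist _ U U_over) => s As; apply/asboolP => a sa /=.
  by right; exists s.
have [idm m1 Jm] := m_over; exists m; split=> // a nma.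
pose I x := exists b c, m c /\ x = a * b + c.
have idI : is_ideal I.
  have [m0 mD mM] := idm; split.
  - by exists 0, 0; rewrite mulr0 addr0.
  - move=> _ _ [b [c [mc ->]]] [b' [c' [mc' ->]]].
    by exists (b + b'), (c + c'); split; [apply: mD|rewrite mulrDr addrACA].
  - move=> x _ [b [c [mc ->]]]; exists (x * b), (x * c); split; first exact: mM.
    by rewrite mulrDr mulrCA.
apply: contrapT => nI1.
have mI x : m x -> I x by move=> mx; exists 0, x; rewrite mulr0 add0r.
have I_over : proper_over I.
  split=> // [[b [c [mc e]]]|x /Jm /mI //].
  by apply: nI1; exists b, c.
have eI : I = m.
  by apply: (congr1 sval (max_m (exist _ I I_over) _)); apply/asboolP.
apply: nma; rewrite -eI; exists 1, 0; rewrite mulr1 addr0; split=> //.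
by case: idm.
Qed.

Section QuotientAlgebra.
Variables (m : R -> Prop) (id_m : is_ideal m) (m1 : ~ m 1).

Definition bool_ideal : {pred R} := [pred a | `[< m a >]].

Fact bool_ideal_closed : idealr_closed bool_ideal.
Proof.
case: id_m => m0 mD mM; split=> [||a x y /asboolP mx /asboolP my].
- exact/asboolP.
- exact/asboolPn.
- by apply/asboolP/mD => //; apply: mM.
Qed.

HB.instance Definition _ := isIdealr.Build R bool_ideal bool_ideal_closed.

Definition ideal_quotient := {ideal_quot bool_ideal}.

HB.instance Definition _ := GRing.ComNzRing.on ideal_quotient.

Definition ideal_proj (a : R) : ideal_quotient := \pi_({ideal_quot bool_ideal})%qT a.

Fact ideal_proj_zmod : zmod_morphism ideal_proj.
Proof. by move=> a b; rewrite /ideal_proj !piE. Qed.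
Fact ideal_proj_monoid : monoid_morphism ideal_proj.
Proof. by split=> [|a b]; rewrite /ideal_proj !piE. Qed.

HB.instance Definition _ :=
  GRing.isZmodMorphism.Build R ideal_quotient ideal_proj ideal_proj_zmod.
HB.instance Definition _ :=
  GRing.isMonoidMorphism.Build R ideal_quotient ideal_proj ideal_proj_monoid.

Lemma ideal_proj_surj x : exists a, ideal_proj a = x.
Proof. by exists (repr x); rewrite /ideal_proj reprK. Qed.

Lemma ideal_proj_eq0 a : ideal_proj a = 0 <-> m a.
Proof.
rewrite -(rmorph0 ideal_proj) /ideal_proj; split.
  by move/eqP; rewrite -Quotient.idealrBE subr0 => /asboolP.
by move=> ma; apply/eqP; rewrite -Quotient.idealrBE subr0; apply/asboolP.
Qed.

Definition ideal_quotient_scale (k : F) (x : ideal_quotient) : ideal_quotient :=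
  ideal_proj k%:A * x.

Fact ideal_quotient_scaleA k l x :
  ideal_quotient_scale k (ideal_quotient_scale l x) = ideal_quotient_scale (k * l) x.
Proof. by rewrite /ideal_quotient_scale mulrA -rmorphM -scalerAl mul1r scalerA. Qed.
Fact ideal_quotient_scale1 : left_id 1 ideal_quotient_scale.
Proof. by move=> x; rewrite /ideal_quotient_scale scale1r rmorph1 mul1r. Qed.
Fact ideal_quotient_scaleDr : right_distributive ideal_quotient_scale +%R.
Proof. by move=> k x y; rewrite /ideal_quotient_scale mulrDr. Qed.
Fact ideal_quotient_scaleDl x : {morph ideal_quotient_scale^~ x : k l / k + l}.
Proof. by move=> k l; rewrite /ideal_quotient_scale scalerDl rmorphD mulrDl. Qed.

HB.instance Definition _ := GRing.Zmodule_isLmodule.Build F ideal_quotient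
  ideal_quotient_scaleA ideal_quotient_scale1 ideal_quotient_scaleDr
  ideal_quotient_scaleDl.

Fact ideal_quotient_scaleAl (k : F) (x y : ideal_quotient) :
  k *: (x * y) = k *: x * y.
Proof. exact: mulrA. Qed.

HB.instance Definition _ :=
  GRing.Lmodule_isLalgebra.Build F ideal_quotient ideal_quotient_scaleAl.
HB.instance Definition _ := GRing.Lalgebra_isComAlgebra.Build F ideal_quotient.

Fact ideal_proj_scalable : scalable ideal_proj.
Proof.
by move=> k a; rewrite /GRing.scale /= /ideal_quotient_scale -rmorphM -scalerAl mul1r.
Qed.
HB.instance Definition _ :=
  GRing.isScalable.Build F R ideal_quotient *:%R ideal_proj ideal_proj_scalable.

End QuotientAlgebra.

(** Surjectivity of [phi] is recorded so that coefficients in [K] can be lifted to [R] in the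
    Nakayama argument. *)
Lemma residue_field (J : R -> Prop) : is_ideal J -> ~ J 1 ->
  exists (K : comAlgType F) (phi : {lrmorphism R -> K}),
    [/\ is_field K, forall a, J a -> phi a = 0 & forall x, exists a, phi a = x].
Proof.
move=> idJ J1; have [m [idm m1 Jm max_m]] := exists_maximal_ideal idJ J1.
exists (ideal_quotient idm m1), (ideal_proj idm m1); split.
- move=> x x0; have [a xa] := ideal_proj_surj x; rewrite -{x}xa in x0 *.
  have /max_m [b [c [mc e]]] : ~ m a.
    by move=> ma; rewrite (iffRL (ideal_proj_eq0 idm m1 a) ma) eqxx in x0.
  exists (ideal_proj idm m1 b); rewrite -rmorphM -(rmorph1 (ideal_proj idm m1)) -e.
  by rewrite rmorphD /= (iffRL (ideal_proj_eq0 idm m1 c) mc) addr0.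
- by move=> a /Jm ma; apply/ideal_proj_eq0.
- exact: ideal_proj_surj.
Qed.

End ResidueField.

(** * Subspaces over a field *)

Section FreeSubspaces.
Variables (F : fieldType) (K : comAlgType F) (K_field : is_field K).
Variable T : lmodType K.

Definition linear_subset (Q : T -> Prop) : Prop :=
  Q 0 /\ forall c x y, Q x -> Q y -> Q (c *: x + y).

Lemma free_rank_independent (P : T -> Prop) n (b : 'I_n -> T) :
  P 0 -> (forall x, P x -> exists! c : 'rV[K]_n, x = \sum_i c 0 i *: b i) ->
  forall c : 'rV[K]_n, \sum_i c 0 i *: b i = 0 -> c = 0.
Proof.
move=> P0 /(_ 0 P0) [c0 [_ c0_uniq]] c c_eq0.
rewrite -(c0_uniq c) // (c0_uniq 0) //.
by rewrite big1 // => i _; rewrite mxE scale0r.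
Qed.

(** Gaussian elimination by induction on [n]. Let [Q1] be the part of [Q] in the span of all [b i]
    except [b 0]. Either [Q1] is all of [Q], or some vector of [Q] has a nonzero coefficient at
    [b 0]; scaled to coefficient 1, it completes a basis of [Q1] to one of [Q]. *)
Lemma free_rank_of_independent n (b : 'I_n -> T) (Q : T -> Prop) :
  (forall c : 'rV[K]_n, \sum_i c 0 i *: b i = 0 -> c = 0) ->
  linear_subset Q ->
  (forall x, Q x -> exists c : 'rV[K]_n, x = \sum_i c 0 i *: b i) ->
  exists2 d, (d <= n)%N & free_rank Q d.
Proof.
elim: n b Q => [|n IH] b Q b_indep [Q0 Qlin] Qb.
  exists 0%N => //; exists (fun _ => 0); split=> [[]//|x Qx].
  have [c ->] := Qb x Qx; exists c; split=> [|c' _]; first by rewrite !big_ord0.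
  by apply/rowP => -[].
have sumE (c : 'rV[K]_n.+1) : \sum_i c 0 i *: b i =
    c 0 0 *: b 0 + \sum_i (\row_j c 0 (lift ord0 j)) 0 i *: b (lift ord0 i).
  by rewrite big_ord_recl; congr (_ + _); apply: eq_bigr => i _; rewrite mxE.
pose Q1 x := Q x /\ exists c : 'rV[K]_n, x = \sum_i c 0 i *: b (lift ord0 i).
have tail_indep (c : 'rV[K]_n) : \sum_i c 0 i *: b (lift ord0 i) = 0 -> c = 0.
  move=> c_eq0; pose c' : 'rV[K]_n.+1 := \row_i if unlift 0 i is Some j then c 0 j else 0.
  have c'0 : c' = 0.
    apply: b_indep; rewrite sumE mxE unlift_none scale0r add0r -[RHS]c_eq0.
    by apply: eq_bigr => i _; rewrite !mxE liftK.
  by apply/rowP => j; have /rowP/(_ (lift ord0 j)) := c'0; rewrite !mxE liftK.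
have Q1_lin : linear_subset Q1.
  split=> [|c x y [Qx [cx xE]] [Qy [cy yE]]].
    by split=> //; exists 0; rewrite big1 // => i _; rewrite mxE scale0r.
  split; first exact: Qlin.
  exists (c *: cx + cy); rewrite xE yE scaler_sumr -big_split /=.
  by apply: eq_bigr => i _; rewrite !mxE scalerDl scalerA.
have Q1_tail x : Q1 x -> exists c : 'rV[K]_n, x = \sum_i c 0 i *: b (lift ord0 i).
  by case.
have [d le_dn [b1 [Q1b1 b1P]]] := IH _ Q1 tail_indep Q1_lin Q1_tail.
have [all_Q1|] := pselect (forall x, Q x -> Q1 x).
  exists d; first exact: leqW; exists b1; split=> [i|x /all_Q1]; last exact: b1P.
  by case: (Q1b1 i).
move=> /existsNP[x0 /not_implyP[Qx0 nQ1x0]].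
have [c0 x0E] := Qb x0 Qx0.
have c00 : c0 0 0 != 0.
  apply/eqP => c00; apply: nQ1x0; split=> //; exists (\row_j c0 0 (lift ord0 j)).
  by rewrite x0E sumE c00 scale0r add0r.
have [a c0a] := K_field c00.
pose y := a *: x0.
have Qy : Q y by rewrite /y -[_ *: _]addr0; apply: Qlin.
have : exists cy : 'rV[K]_n, y = b 0 + \sum_i cy 0 i *: b (lift ord0 i).
  exists (a *: \row_j c0 0 (lift ord0 j)).
  rewrite /y x0E sumE scalerDr scalerA mulrC c0a scale1r scaler_sumr.
  by congr (_ + _); apply: eq_bigr => i _; rewrite !mxE scalerA.
move=> [cy yE].
(* The new basis vector [y] has coefficient 1 at [b 0], so its multiple in any expansion is the
   [b 0]-coordinate; this gives uniqueness. *)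
have coord0 (c : 'rV[K]_n.+1) k (t : 'rV[K]_n) :
    \sum_i c 0 i *: b i = k *: y + \sum_i t 0 i *: b (lift ord0 i) -> c 0 0 = k.
  move=> e; pose c' : 'rV[K]_n.+1 := \row_i if unlift 0 i is Some j
    then k * cy 0 j + t 0 j else k.
  suff /eqP : c - c' = 0 by rewrite subr_eq0 => /eqP ->; rewrite mxE unlift_none.
  apply: b_indep; transitivity (\sum_i c 0 i *: b i - \sum_i c' 0 i *: b i).
    by rewrite -sumrB; apply: eq_bigr => i _; rewrite !mxE scalerBl.
  apply/eqP; rewrite subr_eq0; apply/eqP.
  rewrite e yE (sumE c') mxE unlift_none scalerDr -addrA scaler_sumr -big_split /=.
  congr (_ + _); apply: eq_bigr => i _.
  by rewrite !mxE liftK scalerDl scalerA.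
pose b' (i : 'I_d.+1) := if unlift 0 i is Some j then b1 j else y.
have sum'E (c : 'rV[K]_d.+1) : \sum_i c 0 i *: b' i =
    c 0 0 *: y + \sum_i (\row_j c 0 (lift ord0 j)) 0 i *: b1 i.
  rewrite big_ord_recl /b' unlift_none; congr (_ + _); apply: eq_bigr => i _.
  by rewrite mxE liftK.
exists d.+1 => //; exists b'; split.
  by move=> i; rewrite /b'; case: unliftP => [j _|_] //; case: (Q1b1 j).
move=> x Qx; have [c xE] := Qb x Qx.
have : Q1 (x - c 0 0 *: y).
  split; first by rewrite addrC -scaleNr; apply: Qlin.
  exists ((\row_j c 0 (lift ord0 j)) - c 0 0 *: cy).
  rewrite xE yE sumE scalerDr opprD addrACA subrr add0r scaler_sumr -sumrB.
  by apply: eq_bigr => i _; rewrite !mxE scalerBl scalerA.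
move=> /b1P[c1 [c1E c1_uniq]].
exists (\row_i if unlift 0 i is Some j then c1 0 j else c 0 0); split.
  rewrite sum'E mxE unlift_none -[LHS](subrK (c 0 0 *: y)) addrC c1E; congr (_ + _).
  by apply: eq_bigr => i _; rewrite !mxE liftK.
move=> c' c'E; rewrite sum'E in c'E.
have : Q1 (\sum_i (\row_j c' 0 (lift ord0 j)) 0 i *: b1 i).
  have [Q10 Q1l] := Q1_lin; elim/big_ind: _ => // [u v Q1u Q1v|i _].
    by rewrite -[u]scale1r; apply: Q1l.
  by rewrite -[_ *: _]addr0; apply: Q1l.
move=> [_ [t tE]].
have c00E : c 0 0 = c' 0 0 by apply: (coord0 _ _ t); rewrite -xE c'E tE.
apply/rowP => i; rewrite mxE; case: unliftP => [j ->|->] //.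
rewrite (c1_uniq (\row_j c' 0 (lift ord0 j))) ?mxE // c'E c00E.
by rewrite addrC addKr.
Qed.

End FreeSubspaces.

(** * Cyclic modules and base change *)

HB.instance Definition _ (F : fieldType) (B : falgebra F) (R : comAlgType F)
    (E : bmodule B R) (b : B) :=
  GRing.isLinear.Build R E E *:%R (bact b) (bact_linear b).

(* Finite sums sum r_k (x) b_k in R (x)_F B are represented by lists of pairs. *)
Section Lsum.
Variables (R : nzRingType).

Definition lsum (B : Type) (T : lmodType R) (psi : B -> T) (z : seq (R * B)) : T :=
  \sum_(t <- z) t.1 *: psi t.2.

Definition lscale (B : Type) (c : R) (z : seq (R * B)) := [seq (c * t.1, t.2) | t <- z].
Definition lmap (B B' : Type) (g : B -> B') (z : seq (R * B)) :=
  [seq (t.1, g t.2) | t <- z].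

Variables (B : Type) (T : lmodType R).
Implicit Types (psi : B -> T) (z : seq (R * B)).

Lemma lsum_nil psi : lsum psi [::] = 0.
Proof. exact: big_nil. Qed.

Lemma lsum1 psi a : lsum psi [:: (1, a)] = psi a.
Proof. by rewrite /lsum big_seq1 scale1r. Qed.

Lemma lsum_cat psi z z' : lsum psi (z ++ z') = lsum psi z + lsum psi z'.
Proof. exact: big_cat. Qed.

Lemma lsum_scale psi c z : lsum psi (lscale c z) = c *: lsum psi z.
Proof.
by rewrite /lsum big_map scaler_sumr; apply: eq_bigr => t _; rewrite scalerA.
Qed.

Lemma lsum_map (B' : Type) (psi : B' -> T) (g : B -> B') z :
  lsum psi (lmap g z) = lsum (psi \o g) z.
Proof. exact: big_map. Qed.

Lemma lsum_flatten psi (J : Type) (s : seq J) (z : J -> seq (R * B)) :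
  lsum psi (flatten [seq z j | j <- s]) = \sum_(j <- s) lsum psi (z j).
Proof.
by elim: s => [|j s IH] /=; rewrite ?big_nil ?lsum_nil // lsum_cat IH big_cons.
Qed.

Lemma eq_lsum psi psi' z : psi =1 psi' -> lsum psi z = lsum psi' z.
Proof. by move=> e; apply: eq_bigr => t _; rewrite e. Qed.

Lemma linear_lsum (T' : lmodType R) (f : T -> T') psi z :
  linear f -> f (lsum psi z) = lsum (f \o psi) z.
Proof.
move=> flin; pose f' := GRing.isLinear.Build R T T' *:%R f flin.
pose g : {linear T -> T'} := HB.pack f f'.
rewrite -[f]/(g : T -> T') linear_sum; apply: eq_bigr => t _.
by rewrite linearZ.
Qed.

Lemma lsum_sum (J : Type) (s : seq J) (P : pred J) (g : J -> B -> T) z :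
  lsum (fun a => \sum_(j <- s | P j) g j a) z = \sum_(j <- s | P j) lsum (g j) z.
Proof.
rewrite /lsum exchange_big /=; apply: eq_bigr => t _; exact: scaler_sumr.
Qed.

End Lsum.

Section BModules.
Variables (F : fieldType) (B : falgebra F) (R : comAlgType F).
Implicit Types E : bmodule B R.

Definition lact E (z : seq (R * B)) (x : E) : E := lsum (fun b => bact b x) z.

Definition cyclic E (v : E) : Prop := forall x, exists z, x = lact z v.

(** Only generation is recorded: it passes to base changes, and two generators are multiples of each
    other, which suffices to compare annihilators. *)
Definition part_generator E (e : B) (v : E) : Prop :=
  bact e v = v /\ forall x, bact e x = x -> exists c, x = c *: v.

Lemma lact_linear E z : linear (@lact E z).
Proof.
move=> c x y; rewrite /lact /lsum scaler_sumr -big_split /=.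
by apply: eq_bigr => t _; rewrite bact_linear scalerDr !scalerA mulrC.
Qed.

HB.instance Definition _ E z :=
  GRing.isLinear.Build R E E *:%R (@lact E z) (@lact_linear E z).

Lemma lact_mul E b z (x : E) : lact (lmap ( *%R b) z) x = bact b (lact z x).
Proof.
rewrite /lact lsum_map [RHS](linear_lsum _ _ (bact_linear b)).
by apply: eq_lsum => c; exact: bactM.
Qed.

Lemma bact_sum E (J : Type) (s : seq J) (P : pred J) (b : J -> B) (x : E) :
  bact (\sum_(j <- s | P j) b j) x = \sum_(j <- s | P j) bact (b j) x.
Proof.
apply: (big_morph (fun b => bact b x)) => [b1 b2|]; first exact: bactD.
by apply: (addIr (bact 0 x)); rewrite -bactD !add0r.
Qed.

Lemma lact_submodule E (v : E) : is_submodule (fun x => exists z, x = lact z v).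
Proof.
split=> [|c _ _ [z ->] [z' ->]|b _ [z ->]].
- by exists [::]; rewrite /lact lsum_nil.
- by exists (lscale c z ++ z'); rewrite /lact lsum_cat lsum_scale.
- by exists (lmap ( *%R b) z); rewrite lact_mul.
Qed.

Lemma bmod_iso_sym E E' : bmod_iso E E' -> bmod_iso E' E.
Proof.
move=> [f [flin [g fK gK] fact]]; exists g; split.
- by move=> c x y; apply: (can_inj fK); rewrite flin !gK.
- by exists f.
- by move=> b x; apply: (can_inj fK); rewrite fact !gK.
Qed.

Lemma bmod_iso_trans E E' E'' : bmod_iso E E' -> bmod_iso E' E'' -> bmod_iso E E''.
Proof.
move=> [f [flin fbij fact]] [g [glin gbij gact]]; exists (g \o f); split.
- by move=> c x y /=; rewrite flin glin.
- exact: bij_comp.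
- by move=> b x /=; rewrite fact gact.
Qed.

(** The map z v |-> z v' is well defined in both directions: two lists representing the same vector
    differ by a list in the annihilator. *)
Lemma cyclic_iso E E' (v : E) (v' : E') : cyclic v -> cyclic v' ->
  (forall z, lact z v = 0 <-> lact z v' = 0) -> bmod_iso E E'.
Proof.
move=> cv cv' ann.
have /choice[f fP] : forall x, exists y, exists z, x = lact z v /\ y = lact z v'.
  by move=> x; have [z xz] := cv x; exists (lact z v'), z.
have /choice[g gP] : forall x, exists y, exists z, x = lact z v' /\ y = lact z v.
  by move=> x; have [z xz] := cv' x; exists (lact z v), z.
have eq_lact E1 E2 (v1 : E1) (v2 : E2) :
    (forall z, lact z v1 = 0 -> lact z v2 = 0) ->
    forall z z', lact z v1 = lact z' v1 -> lact z v2 = lact z' v2.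
  move=> sub z z' e; apply/eqP; rewrite -subr_eq0 -scaleN1r; apply/eqP.
  rewrite /lact -lsum_scale -lsum_cat; apply: sub.
  by rewrite /lact lsum_cat lsum_scale scaleN1r; apply/eqP; rewrite subr_eq0; apply/eqP.
have fE z : f (lact z v) = lact z v'.
  by have [z' [/eq_lact e ->]] := fP (lact z v); apply/esym/e => ?; apply ann.
have gE z : g (lact z v') = lact z v.
  by have [z' [/eq_lact e ->]] := gP (lact z v'); apply/esym/e => ?; apply ann.
exists f; split.
- move=> c x y; have [z ->] := cv x; have [z' ->] := cv y.
  rewrite !fE -[c *: _]lsum_scale -[X in f X]lsum_cat [f _]fE.
  by rewrite [LHS]lsum_cat lsum_scale.
- exists g => [x|x]; first by have [z ->] := cv x; rewrite fE gE.
  by have [z ->] := cv' x; rewrite gE fE.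
- by move=> b x; have [z ->] := cv x; rewrite -lact_mul !fE lact_mul.
Qed.

End BModules.

(** * Base change of projective modules through dual bases *)

Section BaseChange.
Variables (F : fieldType) (R S : comAlgType F) (phi : {lrmorphism R -> S}).

Definition lbase (B : Type) (z : seq (R * B)) : seq (S * B) :=
  [seq (phi t.1, t.2) | t <- z].

Section Modules.
Variables (M : lmodType R) (M' : lmodType S) (u : M -> M').
Hypothesis u_bc : is_base_change phi u.

Lemma base_change_sum (J : Type) (s : seq J) (c : J -> R) (x : J -> M) :
  u (\sum_(j <- s) c j *: x j) = \sum_(j <- s) phi (c j) *: u (x j).
Proof.
have [ulin _] := u_bc.
have uD a x1 x2 : u (a *: x1 + x2) = phi a *: u x1 + u x2 by exact: ulin.
have u0 : u 0 = 0.
  by apply: (addrI (u 0)); rewrite addr0 -{1}[u 0]scale1r -(rmorph1 phi) -uD scale1r add0r.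
by elim: s => [|j s IH]; rewrite ?big_nil // !big_cons uD IH.
Qed.

Lemma base_change0 : u 0 = 0.
Proof. by have := base_change_sum [::] (fun _ : unit => 0) (fun _ => 0); rewrite !big_nil. Qed.

Lemma base_changeD x y : u (x + y) = u x + u y.
Proof.
have [ulin _] := u_bc; rewrite -[x]scale1r [LHS]ulin /= rmorph1.
by rewrite scale1r scale1r.
Qed.

Lemma base_change_lsum (B : Type) (psi : B -> M) z :
  u (lsum psi z) = lsum (u \o psi) (lbase z).
Proof. by rewrite /lsum big_map base_change_sum. Qed.

Lemma base_change_ext (N : lmodType S) (w1 w2 : M' -> N) :
  linear w1 -> linear w2 -> (forall x, w1 (u x) = w2 (u x)) -> w1 =1 w2.
Proof.
move=> lin1 lin2 e; have [ulin univ] := u_bc.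
have [|w [_ w_uniq]] := univ N (w2 \o u).
  by move=> c x y /=; rewrite ulin lin2.
by rewrite -(w_uniq w1) // -(w_uniq w2).
Qed.

Variables (N : nat) (s : {linear M -> 'rV[R]_N}) (p : {linear 'rV[R]_N -> M}).
Hypothesis ps : cancel s p.

Lemma dual_basisE x : x = \sum_j s x 0 j *: p (delta_mx 0 j).
Proof.
rewrite -{1}(ps x) {1}[s x]row_sum_delta linear_sum.
by apply: eq_bigr => j _; rewrite linearZ.
Qed.

(** The coordinates [s'] extend [phi] applied to [s] by the universal property. The expansion
    compares two linear endomorphisms of [M'] that agree on the image of [u]. *)
Lemma base_change_dual_basis : exists s' : {linear M' -> 'rV[S]_N},
  (forall x, s' (u x) = map_mx phi (s x)) /\
  forall y, y = \sum_j s' y 0 j *: u (p (delta_mx 0 j)).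
Proof.
have [ulin univ] := u_bc.
have [|s1 [[s1lin s1u] _]] := univ 'rV[S]_N (fun x => map_mx phi (s x)).
  move=> c x y; apply/rowP => j.
  by rewrite !mxE linearP !mxE rmorphD rmorphM.
pose s' : {linear M' -> 'rV[S]_N} := HB.pack s1 (GRing.isLinear.Build _ _ _ _ s1 s1lin).
exists s'; split=> //.
apply: (@base_change_ext M' id) => // [c x y|x].
  rewrite scaler_sumr -big_split; apply: eq_bigr => j _.
  by rewrite [s' _]s1lin !mxE scalerDl scalerA.
rewrite {1}(dual_basisE x) base_change_sum.
by apply: eq_bigr => j _; rewrite [s' _]s1u mxE.
Qed.

End Modules.

Variables (B : falgebra F) (E : bmodule B R) (E' : bmodule B S) (u : E -> E').
Hypotheses (u_bc : is_base_change phi u) (u_act : forall b x, u (bact b x) = bact b (u x)).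

Lemma base_change_lact z x : u (lact z x) = lact (lbase z) (u x).
Proof.
rewrite /lact (base_change_lsum u_bc); apply: eq_lsum => b; exact: u_act.
Qed.

Lemma base_change_span : fg_projective E -> forall y : E',
  exists z : seq (S * E), y = \sum_(t <- z) t.1 *: u t.2.
Proof.
move=> [N [s [p ps]]] y; have [s' [_ /(_ y) yE]] := base_change_dual_basis u_bc ps.
exists [seq (s' y 0 j, p (delta_mx 0 j)) | j <- index_enum 'I_N].
by rewrite big_map.
Qed.

Lemma part_generator_base_change e v : e * e = e -> fg_projective E ->
  part_generator e v -> part_generator e (u v).
Proof.
move=> ee Efg [ev v_gen]; split=> [|x ex]; first by rewrite -u_act ev.
have [z xz] := base_change_span Efg x.
rewrite -ex xz linear_sum.
have /choice[c cP] : forall y, exists k, bact e y = k *: v.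
  by move=> y; apply: v_gen; rewrite -bactM ee.
exists (\sum_(t <- z) t.1 * phi (c t.2)); rewrite scaler_suml.
apply: eq_bigr => t _; rewrite linearZ /= -u_act cP -scalerA; congr (_ *: _).
by have := base_change_sum u_bc [:: tt] (fun _ => c t.2) (fun _ => v); rewrite !big_seq1.
Qed.

Lemma cyclic_base_change v : fg_projective E -> cyclic v -> cyclic (u v).
Proof.
move=> Efg cv x; have [z ->] := base_change_span Efg x.
have [sub0 sublin _] := lact_submodule (u v).
elim/big_ind: _ => // [y y' hy hy'|t _].
  by rewrite -[y]scale1r; exact: sublin.
have [z' ->] := cv t.2; rewrite base_change_lact -[_ *: _]addr0.
by apply: sublin => //; exists (lbase z').
Qed.

End BaseChange.

(** * Stability and cyclicity *)

Lemma big_option (V : nmodType) (W : finType) (f : option W -> V) :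
  \sum_j f j = f None + \sum_i f (Some i).
Proof.
rewrite (bigD1 None) //=; congr (_ + _).
rewrite (reindex_omap Some (fun j => j)) => [|[j|] //=].
by apply: eq_bigl => i; rewrite /= eqxx.
Qed.

Section Stability.
Variables (F : fieldType) (B : falgebra F) (W : finType).
Variables (e : option W -> B) (m : W -> nat).

Section Field.
Variables (K : comAlgType F) (K_field : is_field K) (E : bmodule B K).

Lemma free_rank1_generator_neq0 (v : E) :
  free_rank (vertex_part e None (E := E)) 1 -> part_generator (e None) v -> v != 0.
Proof.
move=> [b [bP b_basis]] [_ v_gen]; apply/eqP => v0.
have [c bE] := v_gen _ (bP 0).
have := @free_rank_independent _ _ _ _ _ b (linear0 _) b_basis (const_mx 1).
rewrite big_ord1 bE v0 !scaler0 => /(_ erefl)/rowP/(_ 0).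
by rewrite !mxE => /eqP; rewrite oner_eq0.
Qed.

(** If Bv were proper, stability would give eta(Bv) > 0. But Bv contains the whole framing part, so
    its dimension is 1 at oo and at most [m i] at each i, whence eta(Bv) <= 0. *)
Lemma stable_cyclic (v : E) : stable e m E ->
  free_rank (vertex_part e None (E := E)) 1 ->
  (forall i, free_rank (vertex_part e (Some i) (E := E)) (m i)) ->
  part_generator (e None) v -> cyclic v.
Proof.
move=> E_stable rk_oo rk v_gen.
have v0 := free_rank1_generator_neq0 rk_oo v_gen.
have N_sub := lact_submodule v; set N := (fun x => _) in N_sub.
have Nv : N v by exists [:: (1, 1)]; rewrite /lact lsum1 bact1.
apply: contrapT => /existsNP N_proper.
have [N0 Nlin Nact] := N_sub.
have /choice[d dP] : forall j, exists d,
    free_rank (fun x => N x /\ vertex_part e j x) d /\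
    if j is Some i then (d <= m i)%N else d = 1%N.
  case=> [i|].
    have [b [bP b_basis]] := rk i.
    have [|||d le_d rk_d] := @free_rank_of_independent _ _ K_field E (m i) b
      (fun x => N x /\ vertex_part e (Some i) x); last by exists d.
    - by apply: free_rank_independent b_basis; exact: linear0.
    - split=> [|c x y [Nx ex] [Ny ey]]; first by split=> //; exact: linear0.
      by split; [exact: Nlin|rewrite /vertex_part linearP /= ex ey].
    - by move=> x [_ /b_basis[c [xE _]]]; exists c.
  exists 1%N; split=> //.
  suff -> : (fun x => N x /\ vertex_part e None x) = vertex_part e None (E := E) by [].
  apply: funext => x; apply: propext; split=> [[]//|ex]; split=> //.
  have [_ /(_ x ex)[c ->]] := v_gen.
  by rewrite -[_ *: _]addr0; exact: Nlin.
have := E_stable N N_sub (ex_intro2 _ _ v Nv v0) N_proper d (fun j => (dP j).1).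
rewrite big_option /= (dP None).2 mulr1.
rewrite addrC subr_gt0 (eq_bigr (fun i => (d (Some i))%:Z)) => [|i _]; last exact: mul1r.
rewrite -(big_morph Posz PoszD erefl) ltz_nat ltnNge => /negP; apply.
by apply: leq_sum => i _; exact: (dP (Some i)).2.
Qed.

(* A submodule with nonzero part at the framing vertex contains v, hence
   everything; all others have eta >= 0, with equality only for 0. *)
Lemma cyclic_stable (v : E) : (forall j, e j * e j = e j) -> \sum_j e j = 1 ->
  part_generator (e None) v -> cyclic v -> stable e m E.
Proof.
move=> ee e1 [ev v_gen] v_cyc N [N0 Nlin Nact] [x Nx x0] [y Ny] d dP.
have rk0 j : d j = 0%N -> forall t, N t -> bact (e j) t = t -> t = 0.
  move=> dj0 t Nt et; have [b [_ /(_ t (conj Nt et))]] := dP j.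
  by move: b; rewrite dj0 => b [c [-> _]]; rewrite big_ord0.
have d_oo : d None = 0%N.
  case dE : (d None) => [//|n]; case: Ny; have := dP None; rewrite dE => -[b [bP b_basis]].
  have [Nb eb] := bP 0; have [c bE] := v_gen _ eb.
  have c0 : c != 0.
    apply/eqP => c0; rewrite c0 scale0r in bE.
    have := @free_rank_independent _ _ _ _ _ b _ b_basis (delta_mx 0 0).
    have -> : \sum_i (delta_mx 0 0 : 'rV[K]_n.+1) 0 i *: b i = 0.
      rewrite big1 // => i _; rewrite mxE eqxx /=; case: eqP => [->|_].
        by rewrite bE scaler0.
      by rewrite scale0r.
    move=> /(_ (conj N0 (linear0 _)) erefl)/rowP/(_ 0).
    by rewrite !mxE => /eqP; rewrite oner_eq0.
  have [a ca] := K_field c0.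
  have Nv : N v.
    have -> : v = a *: b 0 + 0 by rewrite addr0 bE scalerA mulrC ca scale1r.
    exact: Nlin.
  have [z ->] := v_cyc y; rewrite /lact /lsum; elim/big_ind: _ => // [u w Nu Nw|t _].
    by rewrite -[u]scale1r; exact: Nlin.
  by rewrite -[_ *: _]addr0; apply: Nlin => //; exact: Nact.
rewrite big_option d_oo mulr0 add0r (eq_bigr (fun i => (d (Some i))%:Z)) => [|i _];
  last exact: mul1r.
rewrite -(big_morph Posz PoszD erefl) ltz_nat lt0n sum_nat_eq0.
apply: contra_neqN x0 => /forallP d0.
rewrite -[x]bact1 -e1 bact_sum big1 // => j _.
apply: (rk0 j); [|exact: Nact|by rewrite -bactM ee].
by case: j => // i; apply/eqP; exact: d0.
Qed.

End Field.
End Stability.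

(** * Nakayama's lemma for the tautological family *)

Lemma det_scale_mem (F : fieldType) (R : comAlgType F) (T : lmodType R)
    (Q : T -> Prop) n (g : 'I_n -> T) (A : 'M[R]_n) : linear_subset Q ->
  (forall j, Q (\sum_l A j l *: g l)) -> forall i, Q (\det A *: g i).
Proof.
move=> [Q0 Qlin] QA i.
(* Cramer's rule: the adjugate recovers each generator times the determinant from the rows of [A]
   applied to [g]. *)
have -> : \det A *: g i = \sum_j \adj A i j *: (\sum_l A j l *: g l).
  transitivity (\sum_l (\adj A *m A) i l *: g l).
    rewrite mul_adj_mx (bigD1 i) //= big1 ?addr0 => [|l ne]; rewrite mxE ?eqxx //.
    by rewrite eq_sym (negPf ne) scale0r.
  under [RHS]eq_bigr do rewrite scaler_sumr.
  rewrite exchange_big /=; apply: eq_bigr => l _.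
  by rewrite mxE scaler_suml; apply: eq_bigr => j _; rewrite scalerA.
elim/big_ind: _ => // [u w Qu Qw|j _]; first by rewrite -[u]scale1r; exact: Qlin.
by rewrite -[_ *: _]addr0; exact: Qlin.
Qed.

Lemma lbase_surj (F : fieldType) (R S : comAlgType F) (phi : {lrmorphism R -> S})
    (B : Type) (z : seq (S * B)) : (forall c, exists a, phi a = c) ->
  exists z', z = lbase phi z'.
Proof.
move=> phi_surj; elim: z => [|[c b] z [z' ->]]; first by exists [::].
by have [a <-] := phi_surj c; exists ((a, b) :: z').
Qed.

Section Nakayama.
Variables (F : fieldType) (B : falgebra F) (W : finType).
Variables (e : option W -> B) (m : W -> nat).
Hypothesis e_oo : e None * e None = e None.
Variables (X : cfunctor F) (uX : fine_moduli e m X).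

(* Otherwise the ideal of all a with a E contained in Bv lies in a maximal ideal;
   the fibre there is generated by v, and the determinant trick yields an
   element of the ideal which is 1 in the residue field. *)
Lemma taut_cyclic (R : comAlgType F) (x : X R) (v : taut uX x) :
  part_generator (e None) v -> cyclic v.
Proof.
move=> v_gen.
pose N y := exists z, y = lact z v.
have [Nsub0 Nsub_lin _] : is_submodule N by exact: lact_submodule.
have N_lin : linear_subset N by [].
pose J a := forall y, N (a *: y).
suff J1 : J 1 by move=> y; have := J1 y; rewrite scale1r.
apply: contrapT => nJ1.
have idJ : is_ideal J.
  split=> [y|a b Ja Jb y|a b Jb y].
  - by rewrite scale0r.
  - by rewrite scalerDl -[_ *: _]scale1r; exact: Nsub_lin.
  - by rewrite -scalerA -[_ *: _]addr0; exact: Nsub_lin.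
have [K [phi [K_field phiJ phi_surj]]] := residue_field idJ nJ1.
have [Efg _ _] := taut_stable uX x; have [n [s [p ps]]] := Efg.
have [u [u_bc u_act]] := taut_natural uX phi x.
have [s' [s'u _]] := base_change_dual_basis u_bc ps.
have [_ rk_oo fibres] := taut_stable uX (Defs.pmap phi x).
have [rk st] :
    (forall i, free_rank (vertex_part e (Some i) (E := taut uX (Defs.pmap phi x))) (m i))
    /\ stable e m (taut uX (Defs.pmap phi x)).
  (* The family over the field [K] is its own fibre along the identity. *)
  apply: (fibres K idfun) => //; exists id; split=> //; split=> // M w w_lin.
  by exists w; split=> // w' [_ w'E]; apply: funext => y; rewrite -w'E.
have uv_gen := part_generator_base_change u_bc u_act e_oo Efg v_gen.
have uv_cyc := stable_cyclic K_field st rk_oo rk uv_gen.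
pose g j := p (delta_mx 0 j).
have /choice[z zP] : forall j, exists z, u (g j) = u (lact z v).
  move=> j; have [z0 ->] := uv_cyc (u (g j)); have [z ->] := lbase_surj z0 phi_surj.
  by exists z; rewrite (base_change_lact u_bc u_act).
(* Row j of [A] sends the generators to g_j - (g_j - z_j v) = z_j v, which lies in Bv; and [A]
   reduces to the identity over [K], because g_j and z_j v agree there. *)
pose A := \matrix_(j, l) ((j == l)%:R - s (g j - lact (z j) v) 0 l).
have phiA : map_mx phi A = 1%:M.
  apply/matrixP => j l; rewrite !mxE rmorphB rmorph_nat /=.
  suff -> : phi (s (g j - lact (z j) v) 0 l) = 0 by rewrite subr0.
  have u0 : u (g j - lact (z j) v) = 0.
    have [ulin _] := u_bc.
    by rewrite addrC -scaleN1r [u _]ulin /= rmorphN1 scaleN1r -zP addNr.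
  by have /rowP/(_ l) := s'u (g j - lact (z j) v); rewrite u0 linear0 !mxE.
have JdetA : J (\det A).
  move=> y; rewrite (dual_basisE ps y) scaler_sumr; elim/big_ind: _ => //.
    by move=> y1 y2 Ny1 Ny2; rewrite -[y1]scale1r; exact: Nsub_lin.
  move=> j _; rewrite scalerA mulrC -scalerA -[_ *: _]addr0; apply: Nsub_lin => //.
  apply: (det_scale_mem (g := fun j => p (delta_mx 0 j))) => {j} // j.
  suff -> : \sum_l A j l *: p (delta_mx 0 l) = lact (z j) v by exists (z j).
  under eq_bigr do rewrite mxE scalerBl.
  rewrite sumrB -(dual_basisE ps) (bigD1 j) //= eqxx scale1r big1 ?addr0; first by rewrite subKr.
  by move=> l ne; rewrite eq_sym (negPf ne) scale0r.
by have /eqP := phiJ _ JdetA; rewrite -det_map_mx phiA det1 oner_eq0.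
Qed.

End Nakayama.

(** * Compatibility of base change with corners *)

Section Pullbacks.
Variables (F : fieldType) (R S : comAlgType F) (phi : {lrmorphism R -> S}).

Lemma pullback_iso (B : falgebra F) (E1 E2 : bmodule B R) (E' : bmodule B S) :
  bmod_iso E1 E2 -> is_pullback phi E1 E' -> is_pullback phi E2 E'.
Proof.
move=> /bmod_iso_sym[g [glin [f gK fK] gact]] [u [[ulin univ] u_act]].
exists (u \o g); split; last by move=> b x /=; rewrite gact u_act.
split=> [c x y /=|N w wlin]; first by rewrite glin ulin.
have flin : linear f by move=> c x y; apply: (can_inj gK); rewrite glin !fK.
have [|w' [[w'lin w'u] w'_uniq]] := univ N (w \o f).
  by move=> c x y /=; rewrite flin wlin.
exists w'; split; first by split=> // x /=; rewrite w'u /= gK.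
by move=> w2 [w2lin w2u]; apply: w'_uniq; split=> // x; rewrite -[x in LHS]fK; exact: w2u.
Qed.

Variables (B : falgebra F) (e : B) (ee : e * e = e).

(** The projection of E onto eE. The default 0 is never taken, since [bact e x] is fixed by [e]. *)
Definition corner_lift (T : comAlgType F) (E : bmodule B T) (x : E) :
    corner_module ee E := insubd 0 (bact e x).

Lemma corner_liftK (T : comAlgType F) (E : bmodule B T) (x : E) :
  val (corner_lift x) = bact e x.
Proof. by rewrite insubdK // inE -bactM ee. Qed.

Lemma bact_corner (T : comAlgType F) (E : bmodule B T) (x : corner_module ee E) :
  bact e (val x) = val x.
Proof. exact/eqP/(valP x). Qed.

Lemma corner_lift_linear (T : comAlgType F) (E : bmodule B T) :
  linear (@corner_lift T E).
Proof.
by move=> c x y; apply: val_inj; rewrite corner_liftK linearP /= !corner_liftK.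
Qed.

(** As eE is a direct summand of E, a map out of it is extended to E through the projection, base
    changed, and restricted to eE'. Uniqueness is tested on E' after composing with the
    projection. *)
Lemma pullback_corner (E : bmodule B R) (E' : bmodule B S) :
  is_pullback phi E E' -> is_pullback phi (corner_module ee E) (corner_module ee E').
Proof.
move=> [u [u_bc u_act]]; have [ulin univ] := u_bc.
pose u1 (x : corner_module ee E) : corner_module ee E' := corner_lift (u (val x)).
have u1E x : val (u1 x) = u (val x) by rewrite corner_liftK -u_act bact_corner.
exists u1; split; last by move=> b x; apply: val_inj; rewrite u1E /= u_act u1E.
split=> [c x y|N w wlin]; first by apply: val_inj; rewrite /= !u1E ulin.
have [|w' [[w'lin w'u] _]] := univ N (fun x => w (corner_lift x)).
  by move=> c x y; rewrite corner_lift_linear wlin.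
exists (fun y => w' (val y)); split.
  split=> [c x y|x]; first exact: w'lin.
  by rewrite u1E w'u; congr w; apply: val_inj; rewrite corner_liftK bact_corner.
move=> w2 [w2lin w2u]; apply: funext => y.
have yE : y = corner_lift (val y) by apply: val_inj; rewrite corner_liftK bact_corner.
rewrite {2}yE; apply: esym.
have -> : w' (val y) = w' (val (corner_lift (val y))) by rewrite -yE.
have := base_change_ext u_bc (w1 := fun y => w2 (corner_lift y))
  (w2 := fun y => w' (bact e y)).
rewrite corner_liftK; apply.
- by move=> c x1 x2; rewrite corner_lift_linear w2lin.
- by move=> c x1 x2; rewrite linearP w'lin.
move=> x; rewrite -u_act w'u.
have -> : corner_lift (u x) = u1 (corner_lift x).
  by apply: val_inj; rewrite u1E !corner_liftK u_act.
by rewrite w2u; congr w; apply: val_inj; rewrite !corner_liftK -bactM ee.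
Qed.

End Pullbacks.

(** * The module generated by a vector-valued function *)

Section CyclicModule.
Variables (F : fieldType) (B : falgebra F) (S : comAlgType F) (n : nat).
Variable Psi : B -> 'rV[S]_n.

Definition lsum_image : {pred 'rV[S]_n} := [pred w | `[< exists z, w = lsum Psi z >]].

Fact lsum_image_closed : subsemimod_closed lsum_image.
Proof.
split; first split=> [|_ _ /asboolP[z ->] /asboolP[z' ->]].
- by apply/asboolP; exists [::]; rewrite lsum_nil.
- by apply/asboolP; exists (z ++ z'); rewrite lsum_cat.
- by move=> c _ /asboolP[z ->]; apply/asboolP; exists (lscale c z); rewrite lsum_scale.
Qed.

HB.instance Definition _ :=
  GRing.isSubmodClosed.Build S 'rV[S]_n lsum_image lsum_image_closed.

Record lsum_module := LsumModule { lsum_val : 'rV[S]_n; _ : lsum_val \in lsum_image }.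

HB.instance Definition _ := [isSub for lsum_val].
HB.instance Definition _ := [Choice of lsum_module by <:].
HB.instance Definition _ := [SubChoice_isSubLmodule of lsum_module by <:].

Fact lsum_elt_subproof z : lsum Psi z \in lsum_image.
Proof. by apply/asboolP; exists z. Qed.

Definition lsum_elt z : lsum_module := LsumModule (lsum_elt_subproof z).

Lemma lsum_eltP (x : lsum_module) : exists z, x = lsum_elt z.
Proof. by have /asboolP[z xz] := valP x; exists z; apply: val_inj. Qed.

(** [b] multiplies a chosen preimage in S (x) B. The choice is immaterial once left multiplication
    preserves the kernel, which is [Psi_ker]. *)
Definition lsum_act (b : B) (x : lsum_module) : lsum_module :=
  lsum_elt (lmap ( *%R b) (sval (cid (lsum_eltP x)))).

Hypothesis PsiD : {morph Psi : a b / a + b}.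
Hypothesis PsiZ : forall k a, Psi (falg_scal B k * a) = k%:A *: Psi a.
Hypothesis Psi_ker : forall b z, lsum Psi z = 0 -> lsum Psi (lmap ( *%R b) z) = 0.
Variable C : 'I_n -> seq (S * B).
Hypothesis CP : forall a, Psi a = \sum_j Psi a 0 j *: lsum Psi (C j).

Lemma lsum_act_elt b z : lsum_act b (lsum_elt z) = lsum_elt (lmap ( *%R b) z).
Proof.
apply: val_inj => /=; rewrite /lsum_act; case: cid => z' /(congr1 val)/= zz'.
have := @Psi_ker b (z ++ lscale (-1) z').
rewrite lsum_cat lsum_scale zz' scaleN1r subrr => /(_ erefl).
rewrite /lmap map_cat lsum_cat.
have -> : [seq (t.1, b * t.2) | t <- lscale (-1) z'] = lscale (-1) (lmap ( *%R b) z').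
  by rewrite /lscale /lmap -!map_comp.
by rewrite lsum_scale scaleN1r => /eqP; rewrite subr_eq0 => /eqP.
Qed.

Fact lsum_act_linear b : linear (lsum_act b).
Proof.
move=> c x y; have [z ->] := lsum_eltP x; have [z' ->] := lsum_eltP y.
have -> : c *: lsum_elt z + lsum_elt z' = lsum_elt (lscale c z ++ z').
  by apply: val_inj; rewrite /= lsum_cat lsum_scale.
rewrite !lsum_act_elt; apply: val_inj; rewrite /= /lmap map_cat lsum_cat.
by rewrite -lsum_scale /lscale -!map_comp.
Qed.

Fact lsum_actD b c x : lsum_act (b + c) x = lsum_act b x + lsum_act c x.
Proof.
have [z ->] := lsum_eltP x; rewrite !lsum_act_elt; apply: val_inj => /=.
rewrite !lsum_map /lsum -big_split /=; apply: eq_bigr => t _.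
by rewrite mulrDl PsiD scalerDr.
Qed.

Fact lsum_actM b c x : lsum_act (b * c) x = lsum_act b (lsum_act c x).
Proof.
have [z ->] := lsum_eltP x; rewrite !lsum_act_elt; apply: val_inj => /=.
by rewrite !lsum_map; apply: eq_lsum => a /=; rewrite mulrA.
Qed.

Fact lsum_act1 x : lsum_act 1 x = x.
Proof.
have [z ->] := lsum_eltP x; rewrite !lsum_act_elt; apply: val_inj => /=.
by rewrite lsum_map; apply: eq_lsum => a /=; rewrite mul1r.
Qed.

Fact lsum_act_scal (k : F) x : lsum_act (falg_scal B k) x = (k%:A : S) *: x.
Proof.
have [z ->] := lsum_eltP x; rewrite !lsum_act_elt; apply: val_inj => /=.
rewrite lsum_map /lsum scaler_sumr; apply: eq_bigr => t _ /=.
by rewrite PsiZ scalerA mulrC -scalerA.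
Qed.

Definition lsum_bmodule : bmodule B S :=
  BModule lsum_act_linear lsum_actD lsum_actM lsum_act1 lsum_act_scal.

(** The module is the image of S (x) B in S^n, generated by the image of 1. By [CP], sending the
    j-th basis vector to the image of [C j] retracts S^n onto it, so it is projective. *)
Lemma cyclic_bmodule : exists (E : bmodule B S) (w : E),
  [/\ fg_projective E, cyclic w & forall z, lact z w = 0 <-> lsum Psi z = 0].
Proof.
pose w : lsum_bmodule := lsum_elt [:: (1, 1)].
have lactE z : lact z w = lsum_elt z.
  apply: val_inj; rewrite /lact /lsum raddf_sum /=; apply: eq_bigr => t _.
  congr (_ *: _); rewrite -[LHS]/(val (lsum_act t.2 w)).
  by rewrite lsum_act_elt /= /lmap /= lsum1 mulr1.
exists lsum_bmodule, w; split; last first.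
- move=> z; rewrite lactE; split=> [/(congr1 val)//|z0].
  exact: val_inj.
- by move=> x; have [z ->] := lsum_eltP x; exists z; rewrite lactE.
pose p (x : 'rV[S]_n) : lsum_bmodule := \sum_j x 0 j *: (lsum_elt (C j) : lsum_bmodule).
have p_lin : linear p.
  move=> c x y; rewrite /p scaler_sumr -big_split; apply: eq_bigr => j _ /=.
  by rewrite !mxE scalerDl scalerA.
pose s (x : lsum_bmodule) : 'rV[S]_n := val x.
have s_lin : linear s by [].
pose s' : {linear lsum_bmodule -> 'rV[S]_n} :=
  HB.pack s (GRing.isLinear.Build _ _ _ _ s s_lin).
pose p' : {linear 'rV[S]_n -> lsum_bmodule} :=
  HB.pack p (GRing.isLinear.Build _ _ _ _ p p_lin).
exists n, s', p'.
move=> x /=; apply: val_inj; rewrite /p raddf_sum /=.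
have [z ->] := lsum_eltP x; rewrite /s /=.
under eq_bigr => j _.
  rewrite {1}/lsum summxE scaler_suml.
  over.
rewrite exchange_big /= /lsum; apply: eq_bigr => t _.
rewrite [in RHS]CP scaler_sumr; apply: eq_bigr => j _.
by rewrite !mxE scalerA.
Qed.

End CyclicModule.

(** * Corners *)

Lemma lsum_comb (R : nzRingType) (B : Type) (T : lmodType R) (psi : B -> T)
    (J : finType) (c : J -> R) (z : J -> seq (R * B)) :
  lsum psi (flatten [seq lscale (c j) (z j) | j <- index_enum J]) =
  \sum_j c j *: lsum psi (z j).
Proof. by rewrite lsum_flatten; apply: eq_bigr => j _; rewrite lsum_scale. Qed.

Section BModuleIso.
Variables (F : fieldType) (B : falgebra F) (R : comAlgType F).

Lemma bmod_iso_refl (E : bmodule B R) : bmod_iso E E.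
Proof. by exists id; split=> //; exists id. Qed.

Lemma free_rank_transfer (T T' : lmodType R) (P : T -> Prop) (P' : T' -> Prop)
    (f : T -> T') n : linear f ->
  (forall x, P x -> P' (f x)) -> (forall y, P' y -> exists2 x, P x & y = f x) ->
  (forall x, f x = 0 -> x = 0) ->
  free_rank P n -> free_rank P' n.
Proof.
move=> f_lin PP' f_surj f_inj [b [Pb b_basis]].
pose f' : {linear T -> T'} := HB.pack f (GRing.isLinear.Build _ _ _ _ f f_lin).
have fE (c : 'rV[R]_n) : \sum_i c 0 i *: f (b i) = f (\sum_i c 0 i *: b i).
  by rewrite -[f]/(f' : T -> T') linear_sum; apply: eq_bigr => i _; rewrite linearZ.
exists (fun i => f (b i)); split=> [i|y /f_surj[x Px ->]]; first exact: PP'.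
have [c [xE c_uniq]] := b_basis x Px; exists c; split; first by rewrite fE -xE.
move=> c'; rewrite fE => e; apply: c_uniq; apply/eqP; rewrite -subr_eq0; apply/eqP.
apply: f_inj; rewrite -[f]/(f' : T -> T') linearB /=.
by apply/eqP; rewrite subr_eq0; apply/eqP.
Qed.

Lemma free_rank_iso (W : finType) (e : option W -> B) j (E E' : bmodule B R) n :
  bmod_iso E E' ->
  free_rank (vertex_part e j (E := E)) n -> free_rank (vertex_part e j (E := E')) n.
Proof.
move=> [f [f_lin [g fK gK] f_act]]; apply: (free_rank_transfer f_lin).
- by move=> x ex; rewrite /vertex_part -f_act ex.
- move=> y ey; exists (g y); last by rewrite gK.
  by apply: (can_inj fK); rewrite f_act gK.
- move=> x fx0; apply: (can_inj fK); rewrite fx0; apply: esym.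
  by apply: (addrI (f 0)); rewrite -{1}[f 0]scale1r -f_lin scale1r !addr0.
Qed.

Lemma corner_iso (e : B) (ee : e * e = e) (E E' : bmodule B R) :
  bmod_iso E E' -> bmod_iso (corner_module ee E) (corner_module ee E').
Proof.
move=> [f [f_lin [g fK gK] f_act]].
have g_act b x : g (bact b x) = bact b (g x).
  by apply: (can_inj fK); rewrite f_act !gK.
have fP (x : corner_module ee E) :
    val (corner_lift ee (f (val x))) = f (val x).
  by rewrite corner_liftK -f_act bact_corner.
have gP (x : corner_module ee E') :
    val (corner_lift ee (g (val x))) = g (val x).
  by rewrite corner_liftK -g_act bact_corner.
exists (fun x => corner_lift ee (f (val x))); split.
- move=> c x y; apply: val_inj.
  transitivity (c *: val (corner_lift ee (f (val x))) + val (corner_lift ee (f (val y)))).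
    by rewrite !fP -f_lin.
  by [].
- exists (fun x => corner_lift ee (g (val x))) => x; apply: val_inj.
    by rewrite gP fP fK.
  by rewrite fP gP gK.
- by move=> b x; apply: val_inj; rewrite fP /= f_act fP.
Qed.

Lemma free_rank1_generator (W : finType) (e : option W -> B) (E : bmodule B R) j :
  free_rank (vertex_part e j (E := E)) 1 -> exists v : E, part_generator (e j) v.
Proof.
move=> [b [Pb b_basis]]; exists (b 0); split=> [|x /b_basis[c [-> _]]]; first exact: Pb.
by exists (c 0 0); rewrite big_ord1.
Qed.

End BModuleIso.

(** * Orbits of a framing vector in a corner *)

Section Cornering.
Variables (F : fieldType) (B : falgebra F) (W : finType) (e : option W -> B).
Hypothesis e_orth : forall i j, e i * e j = if i == j then e i else 0.
Variable I : {set W}.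
Variable eb : B.
Hypothesis ebE : eb = e None + \sum_(i in I) e (Some i).
Hypothesis ebb : eb * eb = eb.

(** The shape is that of [evert_I], so that the general result specialises by conversion. *)
Definition corner_vertex (j : option {i | i \in I}) : corner_algebra ebb :=
  corner_compress ebb (e (omap val j)).

Definition in_corner (i : option W) : bool := if i is Some w then w \in I else true.

Lemma corner_idemE : eb = \sum_(i | in_corner i) e i.
Proof.
rewrite ebE [RHS]big_mkcond big_option /= [in RHS]big_mkcond /=.
by rewrite [in LHS]big_mkcond /=.
Qed.

Lemma vertex_mul_corner i : in_corner i -> e i * eb = e i.
Proof.
move=> Ii; rewrite corner_idemE mulr_sumr (bigD1 i) //= e_orth eqxx big1 ?addr0 //.
by move=> j /andP[_ ne]; rewrite e_orth eq_sym (negPf ne).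
Qed.

Lemma corner_mul_vertex i : in_corner i -> eb * e i = e i.
Proof.
move=> Ii; rewrite corner_idemE mulr_suml (bigD1 i) //= e_orth eqxx big1 ?addr0 //.
by move=> j /andP[_ ne]; rewrite e_orth (negPf ne).
Qed.

Lemma corner_vertexE j : val (corner_vertex j) = e (omap val j).
Proof.
have Ij : in_corner (omap val j) by case: j => //= i; exact: valP i.
by rewrite /= corner_mul_vertex // vertex_mul_corner.
Qed.

Lemma corner_vertex_idem j : corner_vertex j * corner_vertex j = corner_vertex j.
Proof.
apply: val_inj; rewrite corner_vertexE.
by rewrite -[LHS]/(val (corner_vertex j) * val (corner_vertex j)) corner_vertexE e_orth eqxx.
Qed.

Lemma corner_valK (c : corner_algebra ebb) : eb * val c * eb = val c.
Proof. exact/eqP/(valP c). Qed.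

Lemma corner_val_l (c : corner_algebra ebb) : eb * val c = val c.
Proof. by rewrite -(corner_valK c) !mulrA ebb. Qed.

Local Notation compress b := (corner_compress ebb b : corner_algebra ebb).

Section Action.
Variables (S : comAlgType F) (T : bmodule (corner_algebra ebb) S).

(* the action of A e_oo on v through A_I e_oo *)
Definition corner_orbit (v : T) (a : B) : T := bact (compress (a * e None)) v.

Lemma corner_orbitD v : {morph corner_orbit v : a b / a + b}.
Proof.
move=> a b; rewrite /corner_orbit -bactD; congr (bact _ v); apply: val_inj.
change (eb * ((a + b) * e None) * eb = eb * (a * e None) * eb + eb * (b * e None) * eb).
by rewrite mulrDl mulrDr mulrDl.
Qed.

Lemma corner_orbit_sum v (J : Type) (s : seq J) (P : pred J) (a : J -> B) :
  corner_orbit v (\sum_(j <- s | P j) a j) = \sum_(j <- s | P j) corner_orbit v (a j).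
Proof.
apply: (big_morph (corner_orbit v)); first exact: corner_orbitD.
by apply: (addIr (corner_orbit v 0)); rewrite -corner_orbitD !add0r.
Qed.

Lemma corner_orbitZ v k a :
  corner_orbit v (falg_scal B k * a) = (k%:A : S) *: corner_orbit v a.
Proof.
rewrite /corner_orbit -bact_scal -bactM; congr (bact _ v); apply: val_inj.
change (eb * (falg_scal B k * a * e None) * eb =
  eb * falg_scal B k * eb * (eb * (a * e None) * eb)).
by rewrite !mulrA -(mulrA _ eb eb) ebb -(mulrA eb _ eb) falg_central mulrA ebb.
Qed.

Lemma corner_orbit_vertex v i a : in_corner i ->
  corner_orbit v (e i * a) = bact (compress (e i)) (corner_orbit v a).
Proof.
move=> Ii; rewrite /corner_orbit -bactM; congr (bact _ v); apply: val_inj.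
change (eb * (e i * a * e None) * eb = eb * e i * eb * (eb * (a * e None) * eb)).
rewrite -[in RHS](mulrA eb) vertex_mul_corner // !mulrA.
by rewrite -[in RHS](mulrA eb) vertex_mul_corner.
Qed.

Lemma corner_orbit_val v (c : corner_algebra ebb) : bact (corner_vertex None) v = v ->
  corner_orbit v (val c) = bact c v.
Proof.
move=> ev; rewrite -[in RHS]ev -bactM; congr (bact _ v); apply: val_inj.
change (eb * (val c * e None) * eb = val c * val (corner_vertex None)).
by rewrite corner_vertexE mulrA corner_val_l -mulrA vertex_mul_corner.
Qed.

Lemma corner_orbit_scale c v a : corner_orbit (c *: v) a = c *: corner_orbit v a.
Proof. exact: linearZ. Qed.

Lemma corner_orbit_framing v : corner_orbit v (e None) = corner_orbit v 1.
Proof. by rewrite /corner_orbit e_orth eqxx mul1r. Qed.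

End Action.

Section Module.
Variables (S : comAlgType F) (E : bmodule B S).

Lemma corner_framing (w : E) : bact (e None) w = w -> bact eb w = w.
Proof. by move=> ew; rewrite -ew -bactM corner_mul_vertex. Qed.

Lemma lsum_corner_orbit (w : corner_module ebb E) z : bact (e None) (val w) = val w ->
  val (lsum (corner_orbit w) z) = bact eb (lact z (val w)).
Proof.
move=> ew; rewrite /lact /lsum raddf_sum /= linear_sum.
apply: eq_bigr => t _; rewrite [RHS]linearZ /=; congr (_ *: _).
by rewrite !bactM bact_corner ew.
Qed.

(** For a vertex of the corner, e_j E lies in eb E, so both vertex parts have the same elements.
    This transfers ranks from the corner families to the glued one. *)
Lemma free_rank_corner j n :
  free_rank (vertex_part corner_vertex j (E := corner_module ebb E)) n ->
  free_rank (vertex_part e (omap val j) (E := E)) n.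
Proof.
have vj := corner_vertexE j.
apply: (@free_rank_transfer _ _ _ E _ _ val) => //.
- move=> x /(congr1 val) ex; rewrite /vertex_part -vj.
  exact: ex.
- move=> y ey; have eby : bact eb y = y.
    rewrite -[y]ey -bactM corner_mul_vertex //.
    by case: j {vj ey} => //= i; exact: valP i.
  have yK : val (corner_lift ebb y) = y by rewrite corner_liftK.
  exists (corner_lift ebb y) => //; apply: val_inj.
  rewrite -[LHS]/(bact (val (corner_vertex j)) (val (corner_lift ebb y))).
  by rewrite vj yK ey.
- by move=> x x0; apply: val_inj.
Qed.

End Module.

(* w and v correspond, up to a unit, under the isomorphism of framed modules *)
Lemma corner_orbit_ann (S : comAlgType F) (E : bmodule B S)
    (T : bmodule (corner_algebra ebb) S) (w : E) (v : T) :
  bmod_iso (corner_module ebb E) T ->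
  part_generator (e None) w -> part_generator (corner_vertex None) v ->
  forall z, lsum (corner_orbit v) z = 0 <-> bact eb (lact z w) = 0.
Proof.
move=> [f [f_lin [g fK gK] f_act]] [ew w_gen] [ev v_gen] z.
pose f' : {linear corner_module ebb E -> T} :=
  HB.pack f (GRing.isLinear.Build _ _ _ _ f f_lin).
pose w1 : corner_module ebb E := corner_lift ebb w.
have w1E : val w1 = w by rewrite corner_liftK corner_framing.
have [c fw1] : exists c, f w1 = c *: v.
  apply: v_gen; rewrite -f_act; congr f; apply: val_inj.
  by rewrite /= -[X in bact X _]/(val (corner_vertex None)) corner_vertexE w1E.
have [c' vE] : exists c, v = c *: f w1.
  have gev : bact (corner_vertex None) (g v) = g v.
    by apply: (can_inj fK); rewrite f_act gK.
  have [|k gvE] := w_gen (val (g v)).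
    by rewrite -(corner_vertexE None); exact: (congr1 val gev).
  exists k; rewrite -{1}(gK v); transitivity (f (k *: w1)); last exact: (linearZZ f').
  congr f; by apply: val_inj; rewrite /= -/(val _) w1E gvE.
have orbit_eq0 (c0 : S) (v0 v1 : T) : v1 = c0 *: v0 ->
    lsum (corner_orbit v0) z = 0 -> lsum (corner_orbit v1) z = 0.
  move=> -> e0; rewrite (eq_lsum (psi' := fun a => c0 *: corner_orbit v0 a)).
    by rewrite -(linear_lsum _ _ (f := *:%R c0)) ?e0 ?scaler0 // => k x y; rewrite linearP.
  exact: corner_orbit_scale.
have fz : lsum (corner_orbit (f w1)) z = f (lsum (corner_orbit w1) z).
  by rewrite (linear_lsum _ _ f_lin); apply: eq_lsum => a; exact: esym (f_act _ _).
have -> : lsum (corner_orbit v) z = 0 <-> lsum (corner_orbit (f w1)) z = 0.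
  by split; [exact: orbit_eq0 fw1|exact: orbit_eq0 vE].
rewrite fz -w1E -lsum_corner_orbit ?w1E //; split=> [fz0|/= z0].
  have -> : lsum (corner_orbit w1) z = 0 by rewrite -(fK (lsum _ z)) fz0 -(linear0 f') fK.
  by [].
have -> : lsum (corner_orbit w1) z = 0 by apply: val_inj.
exact: (linear0 f').
Qed.

End Cornering.

(** * Gluing modules over the corners *)

Section CorneringProduct.
Variables (F : fieldType) (B : falgebra F) (W : finType) (e : option W -> B).
Hypothesis e_orth : forall i j, e i * e j = if i == j then e i else 0.
Hypothesis e_sum : \sum_i e i = 1.
Variables (l : nat) (I : 'I_l -> {set W}).
Hypothesis l_gt0 : (0 < l)%N.
Hypothesis I_cover : forall w, exists k, w \in I k.
Variable eb : 'I_l -> B.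
Hypothesis ebE : forall k, eb k = e None + \sum_(i in I k) e (Some i).
Hypothesis ebb : forall k, eb k * eb k = eb k.
Variable m : W -> nat.
Variables (M : cfunctor F) (uM : fine_moduli e m M).
Variable Quot : 'I_l -> cfunctor F.
Local Notation ek k := (@corner_vertex F B W e (I k) (eb k) (ebb k)).
Variable uQuot : forall k, fine_moduli (ek k) (fun i => m (val i)) (Quot k).
Variable c : forall k, cmorphism M (Quot k).
Hypothesis c_corner : forall k (S : comAlgType F) (x : M S),
  bmod_iso (corner_module (ebb k) (taut uM x)) (taut (uQuot k) (c k S x)).

Lemma idem_e i : e i * e i = e i.
Proof. by rewrite e_orth eqxx. Qed.

Lemma idem_ek k j : ek k j * ek k j = ek k j.
Proof. exact: (corner_vertex_idem e_orth (ebE k)). Qed.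

(** The framing vertex belongs to every corner, so any index serves for it, and [l_gt0] provides
    one. *)
Lemma covering_corner : exists kk : option W -> 'I_l, forall i, in_corner (I (kk i)) i.
Proof.
suff /choice[kk kkP] : forall i, exists k, in_corner (I k) i by exists kk.
by case=> [w|]; [exact: I_cover | exists (Ordinal l_gt0)].
Qed.

Lemma vertices_eq0 (S : comAlgType F) (E : bmodule B S) (x : E) :
  (forall i, bact (e i) x = 0) -> x = 0.
Proof. by move=> ex; rewrite -[x]bact1 -e_sum bact_sum big1. Qed.

Lemma corner_eq0 (S : comAlgType F) (E : bmodule B S) (x : E) k i :
  bact (eb k) x = 0 -> in_corner (I k) i -> bact (e i) x = 0.
Proof.
move=> ex Ii; rewrite -(vertex_mul_corner e_orth (ebE k) Ii) bactM ex.
exact: linear0.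
Qed.

Lemma corners_eq0 (S : comAlgType F) (E : bmodule B S) (x : E) :
  (forall k, bact (eb k) x = 0) -> x = 0.
Proof.
move=> ex; have [kk kkP] := covering_corner; apply: vertices_eq0 => i.
exact: corner_eq0 (ex (kk i)) (kkP i).
Qed.

(** [y] is a separate variable because the type of [v] depends on it: the same [v] is compared with
    different points [x] having image [y]. *)
Lemma point_ann (S : comAlgType F) (x : M S) k (y : Quot k S) (w : taut uM x)
    (v : taut (uQuot k) y) : c k S x = y ->
  part_generator (e None) w -> part_generator (ek k None) v ->
  forall z, lsum (corner_orbit e v) z = 0 <-> bact (eb k) (lact z w) = 0.
Proof.
move=> xy; move: v; rewrite -xy => v w_gen v_gen.
exact: (corner_orbit_ann e_orth (ebE k) (c_corner k x)).
Qed.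

Lemma corner_points_inj (S : comAlgType F) (x x' : M S) :
  (forall k, c k S x = c k S x') -> x = x'.
Proof.
move=> xx'; have [_ x_rk _] := taut_stable uM x; have [_ x'_rk _] := taut_stable uM x'.
have [w w_gen] := free_rank1_generator x_rk.
have [w' w'_gen] := free_rank1_generator x'_rk.
have [t [_ t_uniq]] := taut_universal uM (taut_stable uM x).
rewrite -(t_uniq x) ?(t_uniq x') //; last exact: bmod_iso_refl.
apply: (cyclic_iso (taut_cyclic (idem_e None) w_gen) (taut_cyclic (idem_e None) w'_gen)).
suff ann z : forall k, bact (eb k) (lact z w) = 0 <-> bact (eb k) (lact z w') = 0.
  move=> z; split=> z0; apply: corners_eq0 => k; apply/(ann z k); rewrite z0; exact: linear0.
move=> k; have [_ v_rk _] := taut_stable (uQuot k) (c k S x).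
have [v v_gen] := free_rank1_generator v_rk.
have [h1 h1'] := point_ann erefl w_gen v_gen z.
have [h2 h2'] := point_ann (esym (xx' k)) w'_gen v_gen z.
by split=> [/h1'/h2|/h2'/h1].
Qed.

(** Necessity of the gluing condition: if z v_k = 0 then eb_k z w = 0 in the family of A-modules,
    hence e_i z w = 0 and b e_i z w = 0, which is read off in the corner k'. *)
Lemma point_compat (S : comAlgType F) (x : M S) (y : forall k, Quot k S)
    (v : forall k, taut (uQuot k) (y k)) :
  (forall k, c k S x = y k) -> (forall k, part_generator (ek k None) (v k)) ->
  forall k k' i b z, in_corner (I k) i -> lsum (corner_orbit e (v k)) z = 0 ->
  lsum (fun a => corner_orbit e (v k') (b * (e i * a))) z = 0.
Proof.
move=> xy v_gen k k' i b z Ii; have [_ w_rk _] := taut_stable uM x.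
have [w w_gen] := free_rank1_generator w_rk.
move/(point_ann (xy k) w_gen (v_gen k)) => /corner_eq0/(_ Ii) ez0.
have := lsum_map (corner_orbit e (v k')) (fun a => b * (e i * a)) z.
rewrite /comp => <-; apply/(point_ann (xy k') w_gen (v_gen k')).
have -> : lmap (fun a => b * (e i * a)) z = lmap ( *%R b) (lmap ( *%R (e i)) z).
  by rewrite /lmap -map_comp.
by rewrite !lact_mul ez0 !linear0.
Qed.

Section Gluing.
Variables (S : comAlgType F) (y : forall k, Quot k S).
Local Notation T k := (taut (uQuot k) (y k)).
Variable v : forall k, T k.
Hypothesis v_gen : forall k, part_generator (ek k None) (v k).
Local Notation psi k := (corner_orbit e (v k)).
Hypothesis v_compat : forall k k' i b z, in_corner (I k) i ->
  lsum (psi k) z = 0 -> lsum (fun a => psi k' (b * (e i * a))) z = 0.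

Lemma orbit_vertices k (b a : B) : psi k (b * a) = \sum_i psi k (b * (e i * a)).
Proof.
rewrite -corner_orbit_sum -mulr_sumr; congr (corner_orbit _ _ (_ * _)).
by rewrite -mulr_suml e_sum mul1r.
Qed.

(** As z kills every v_k, the summand b e_i z can be treated through the corner [kk i] containing i,
    even if i is not in I_k. *)
Lemma orbit_kernel_stable b z : (forall k, lsum (psi k) z = 0) ->
  forall k, lsum (psi k) (lmap ( *%R b) z) = 0.
Proof.
move=> z0 k; have [kk kkP] := covering_corner.
rewrite lsum_map (eq_lsum (psi' := fun a => \sum_i psi k (b * (e i * a)))); last first.
  by move=> a; exact: orbit_vertices.
rewrite (lsum_sum _ _ (fun i a => psi k (b * (e i * a)))) big1 // => i _.
exact: v_compat (kkP i) (z0 _).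
Qed.

(** The module generated by (v_k) in the direct sum of the T_k, which is embedded in a free module
    by the coordinates [s k]. *)
Lemma glued_module : exists (E : bmodule B S) (w : E),
  [/\ fg_projective E, cyclic w &
      forall z, lact z w = 0 <-> forall k, lsum (psi k) z = 0].
Proof.
have [kk kkP] := covering_corner.
have bases k : {n : nat & {s : {linear T k -> 'rV[S]_n} &
    {p : {linear 'rV[S]_n -> T k} | cancel s p}}}.
  have [Tfg _ _] := taut_stable (uQuot k) (y k).
  by have [n /cid[s /cid[p ps]]] := cid Tfg; exists n, s, p.
pose n k := projT1 (bases k); pose s k := projT1 (projT2 (bases k)).
pose p k := sval (projT2 (projT2 (bases k))).
have ps k : cancel (s k) (p k) := svalP (projT2 (projT2 (bases k))).
pose J := {k : 'I_l & 'I_(n k)}.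
have /choice[gz gzP] : forall j : J, exists z, p (tag j) (delta_mx 0 (tagged j)) =
    lsum (psi (tag j)) z.
  move=> [k t] /=.
  have [z ->] := taut_cyclic (@idem_ek k None) (v_gen k) (p k (delta_mx 0 t)).
  exists (lmap val z); rewrite lsum_map; apply: eq_lsum => b /=.
  by rewrite (corner_orbit_val e_orth (ebE k)) //; case: (v_gen k).
pose Psi a : 'rV[S]_#|{: J}| :=
  \row_q s (tag (enum_val q)) (psi (tag (enum_val q)) a) 0 (tagged (enum_val q)).
have PsiE z q : lsum Psi z 0 q =
    s (tag (enum_val q)) (lsum (psi (tag (enum_val q))) z) 0 (tagged (enum_val q)).
  rewrite /lsum linear_sum !summxE; apply: eq_bigr => t _.
  by rewrite linearZ !mxE.
have Psi0 z : lsum Psi z = 0 <-> forall k, lsum (psi k) z = 0.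
  split=> [z0 k|z0]; last by apply/rowP => q; rewrite PsiE z0 linear0 !mxE.
  rewrite -(ps k (lsum _ z)) (_ : s k _ = 0) ?linear0 //; apply/rowP => t.
  have := PsiE z (enum_rank (Tagged (fun k => 'I_(n k)) t : J)).
  by rewrite z0 enum_rankK /= !mxE.
(* Each vertex is counted in one corner only, so the [eps k] sum to 1 even where the I_k overlap.
   The retraction sends a dual basis vector of T_k to [eps k] times its lift [gz]. *)
pose eps (k : 'I_l) := \sum_(i | kk i == k) e i.
pose C (q : 'I_#|{: J}|) := lmap ( *%R (eps (tag (enum_val q)))) (gz (enum_val q)).
(* The dual basis expansion of a v_k lifts to a list z with (z - a) v_k = 0. Compatibility with b =
   1 then gives e_i z v_k' = e_i a v_k'. *)
have psi_decomp k k' i a : kk i = k ->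
    \sum_(t < n k) s k (psi k a) 0 t *:
      lsum (fun b => psi k' (e i * b)) (gz (Tagged (fun k => 'I_(n k)) t)) = psi k' (e i * a).
  move=> kki; have Ii : in_corner (I k) i by rewrite -kki.
  pose z := flatten [seq lscale (s k (psi k a) 0 t)
    (gz (Tagged (fun k => 'I_(n k)) t)) | t <- index_enum 'I_(n k)].
  have zE : lsum (psi k) z = psi k a.
    rewrite lsum_comb [RHS](dual_basisE (ps k)); apply: eq_bigr => t _.
    by congr (_ *: _); exact: esym (gzP (Tagged (fun k => 'I_(n k)) t)).
  have := @v_compat k k' i 1 (z ++ lscale (-1) [:: (1, a)]) Ii.
  rewrite !lsum_cat !lsum_scale !lsum1 zE scaleN1r subrr => /(_ erefl)/eqP.
  rewrite scaleN1r subr_eq0 mul1r => /eqP <-; rewrite lsum_comb.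
  by apply: eq_bigr => t _; congr (_ *: _); apply: eq_lsum => b; rewrite mul1r.
have psi_CP k' a : \sum_q Psi a 0 q *: lsum (psi k') (C q) = psi k' a.
  pose G (j : J) := s (tag j) (psi (tag j) a) 0 (tagged j) *:
    lsum (psi k') (lmap ( *%R (eps (tag j))) (gz j)).
  transitivity (\sum_j G j).
    rewrite [RHS](reindex _ (onW_bij _ (@enum_val_bij J))) /=.
    by apply: eq_bigr => q _; rewrite mxE.
  transitivity (\sum_k psi k' (eps k * a)).
    have -> : \sum_j G j = \sum_k \sum_(t < n k) G (Tagged (fun k => 'I_(n k)) t).
      by rewrite sig_big_dep /=; apply: eq_bigr => -[].
    apply: eq_bigr => k _; rewrite /eps mulr_suml corner_orbit_sum.
    under [RHS]eq_bigr => i /eqP kki do rewrite -(psi_decomp k k' i a kki).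
    rewrite exchange_big; apply: eq_bigr => t _ /=.
    rewrite -scaler_sumr -lsum_sum /G /= lsum_map; congr (_ *: _).
    by apply: eq_lsum => b /=; rewrite /eps mulr_suml corner_orbit_sum.
  rewrite -corner_orbit_sum -mulr_suml /eps.
  have <- : 1 = \sum_k \sum_(i | kk i == k) e i by rewrite -e_sum (partition_big kk xpredT).
  by rewrite mul1r.
have CP a : Psi a = \sum_q Psi a 0 q *: lsum Psi (C q).
  apply/rowP => q; rewrite summxE; under eq_bigr do rewrite mxE PsiE.
  rewrite [LHS]mxE -[in LHS]psi_CP linear_sum summxE.
  by apply: eq_bigr => q' _; rewrite linearZ !mxE.
have [|||E [w [Efg wcyc wann]]] := @cyclic_bmodule F B S _ Psi _ _ _ C CP.
- move=> a b; apply/rowP => q; rewrite !mxE corner_orbitD linearD !mxE //.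
- by move=> k a; apply/rowP => q; rewrite !mxE corner_orbitZ linearZ !mxE.
- by move=> b z /Psi0 z0; apply/Psi0; exact: orbit_kernel_stable.
by exists E, w; split=> // z; rewrite wann.
Qed.

Lemma glued_point : exists x : M S, forall k, c k S x = y k.
Proof.
have [E [w [Efg w_cyc w_ann]]] := glued_module.
have framing_w : bact (e None) w = w.
  apply/eqP; rewrite -subr_eq0; apply/eqP.
  have -> : bact (e None) w - w = lact ([:: (1, e None)] ++ lscale (-1) [:: (1, 1)]) w.
    by rewrite /lact lsum_cat lsum_scale !lsum1 bact1 scaleN1r.
  apply/w_ann => k; rewrite lsum_cat lsum_scale !lsum1 corner_orbit_framing //.
  by rewrite scaleN1r subrr.
have orbit_val k (b : corner_algebra (ebb k)) : psi k (val b) = bact b (v k).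
  by apply: (corner_orbit_val e_orth (ebE k)); case: (v_gen k).
have isoE k : bmod_iso (corner_module (ebb k) E) (T k).
  pose w1 := corner_lift (ebb k) w.
  have w1E : val w1 = w by rewrite corner_liftK (corner_framing e_orth (ebE k)).
  have lact_w1 z : val (lact z w1) = lact (lmap val z) w.
    rewrite /lact lsum_map /lsum raddf_sum; apply: eq_bigr => t _.
    by rewrite /= -[corner_mod_val w1]/(val w1) w1E.
  apply: (@cyclic_iso _ _ _ _ _ w1 (v k)).
  - move=> x; have [z xz] := w_cyc (val x).
    exists (lmap (corner_compress (ebb k)) z); apply: val_inj; rewrite lact_w1.
    rewrite -[LHS]bact_corner xz /lact !lsum_map (linear_lsum _ _ (bact_linear (eb k))).
    apply: eq_lsum => a /=; rewrite !bactM.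
    by rewrite (corner_framing e_orth (ebE k) framing_w).
  - exact: (taut_cyclic (@idem_ek k None) (v_gen k)).
  move=> z; have lact_v : lact z (v k) = lsum (psi k) (lmap val z).
    by rewrite lsum_map; apply: eq_lsum => b /=; rewrite orbit_val.
  rewrite lact_v; split=> [/(congr1 val)|z0].
    by rewrite lact_w1 => /w_ann.
  apply: val_inj; rewrite lact_w1; apply/w_ann => k'.
  (* An element of the corner algebra is the sum of its e_i-components for i in the corner, so by
     [v_compat] what kills v_k also kills every v_k'. *)
  have e_decomp b : psi k' (val (b : corner_algebra (ebb k))) =
      \sum_(i | in_corner (I k) i) psi k' (1 * (e i * val b)).
    rewrite -corner_orbit_sum -mulr_sumr mul1r -mulr_suml -(corner_idemE (ebE k)).
    by rewrite corner_val_l.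
  rewrite lsum_map (eq_lsum _ e_decomp).
  rewrite (lsum_sum _ _ (fun i b => psi k' (1 * (e i * val b)))) big1 // => i Ii.
  by have := @v_compat k k' i 1 _ Ii z0; rewrite lsum_map.
have rank_E (K : comAlgType F) (E' : bmodule B K) k j d :
    free_rank (vertex_part (ek k) j (E := corner_module (ebb k) E')) d ->
    free_rank (vertex_part e (omap val j) (E := E')) d.
  exact: (free_rank_corner e_orth (ebE k)).
have E_stable : stable_family e m E.
  split=> //.
    pose k := Ordinal l_gt0; apply: (rank_E S E k None).
    apply: free_rank_iso (bmod_iso_sym (isoE k)) _.
    by have [] := taut_stable (uQuot k) (y k).
  move=> K phi E' K_field EE'; split=> [i|].
    (* The rank at i is read off in the fibre of a corner family whose corner contains i. *)
    have [k Iki] := I_cover i.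
    have [_ _ fibres] := taut_stable (uQuot k) (y k).
    have [rk _] := fibres K phi _ K_field
      (pullback_iso (isoE k) (pullback_corner (ebb k) EE')).
    exact: (rank_E K E' k (Some (exist _ i Iki)) _ (rk _)).
  have [u [u_bc u_act]] := EE'.
  have w_gen : part_generator (e None) w.
    split=> // x ex; have [z xz] := w_cyc x; pose k := Ordinal l_gt0.
    have psi_e k' : psi k' (e None) = v k'.
      have eE : val (ek k' None) = e None by exact: (corner_vertexE e_orth (ebE k')).
      by rewrite -eE orbit_val; case: (v_gen k').
    have ek_psi : bact (ek k None) (lsum (psi k) (lmap ( *%R (e None)) z)) =
        lsum (psi k) (lmap ( *%R (e None)) z).
      rewrite (linear_lsum _ _ (bact_linear (ek k None))) !lsum_map; apply: eq_lsum => a /=.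
      transitivity (psi k (e None * (e None * a))); last by rewrite mulrA idem_e.
      by apply: esym; apply: (corner_orbit_vertex e_orth (ebE k)).
    have [_ /(_ _ ek_psi)[c0 c0E]] := v_gen k; exists c0.
    (* The scalar [c0] is found in one corner. The difference e_oo z - c0 e_oo kills v_k there, and
       compatibility at the framing vertex, common to all corners, makes it kill every v_k'. *)
    pose z' := lmap ( *%R (e None)) z ++ lscale (- c0) [:: (1, e None)].
    have z'0 : lsum (psi k) z' = 0.
      by rewrite lsum_cat lsum_scale lsum1 c0E psi_e scaleNr subrr.
    have : lact z' w = 0.
      apply/w_ann => k'; have := @v_compat k k' None 1 z' isT z'0.
      rewrite !lsum_cat !lsum_scale !lsum1 !lsum_map mul1r idem_e.
      rewrite (eq_lsum (psi' := psi k' \o *%R (e None))) // => a /=.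
      by rewrite mul1r mulrA idem_e.
    rewrite /lact lsum_cat lsum_scale lsum1 -/(lact _ w) lact_mul -xz ex framing_w.
    by rewrite scaleNr => /eqP; rewrite subr_eq0 => /eqP.
  apply: (@cyclic_stable _ _ _ e m K K_field E' (u w) idem_e e_sum).
    exact: (part_generator_base_change u_bc u_act (idem_e None) Efg w_gen).
  exact: (cyclic_base_change u_bc u_act Efg w_cyc).
have [x [Ex _]] := taut_universal uM E_stable; exists x => k.
(* Both [y k] and the image of [x] classify T_k, so they coincide. *)
have [t [_ t_uniq]] := taut_universal (uQuot k) (taut_stable (uQuot k) (y k)).
rewrite -(t_uniq (y k)) ?(t_uniq (c k S x)) //; last exact: bmod_iso_refl.
apply: bmod_iso_trans (bmod_iso_sym (isoE k)) _.
exact: bmod_iso_trans (corner_iso (ebb k) Ex) (c_corner k x).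
Qed.

End Gluing.

(** * The gluing condition as a closed condition on the base *)

Lemma base_change_generators (R S : comAlgType F) (phi : {lrmorphism R -> S})
    (y : forall k, Quot k R) (v : forall k, taut (uQuot k) (y k)) :
  (forall k, part_generator (ek k None) (v k)) ->
  exists u : forall k, taut (uQuot k) (y k) -> taut (uQuot k) (Defs.pmap phi (y k)),
    forall k, [/\ is_base_change phi (u k), forall b x, u k (bact b x) = bact b (u k x)
      & part_generator (ek k None) (u k (v k))].
Proof.
move=> v_gen.
have /all_sig[u uP] k : {u : taut (uQuot k) (y k) -> taut (uQuot k) (Defs.pmap phi (y k)) |
    is_base_change phi u /\ forall b x, u (bact b x) = bact b (u x)}.
  exact: (cid (taut_natural (uQuot k) phi (y k))).
exists u => k; have [u_bc u_act] := uP k; split=> //.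
have [Tfg _ _] := taut_stable (uQuot k) (y k).
exact: (part_generator_base_change u_bc u_act (@idem_ek k None) Tfg (v_gen k)).
Qed.

(* The closed subscheme of Spec R is cut out by the functions vanishing on all
   points of M over y. *)
Theorem cornering_closed_immersion : closed_immersion (cprod_mor c).
Proof.
move=> R y.
pose J a := forall (S : comAlgType F) (phi : {lrmorphism R -> S}),
  (exists x : M S, cprod_mor c S x = Defs.pmap phi y) -> phi a = 0.
exists J; split.
  split=> [S phi _|a b Ja Jb S phi xP|a b Jb S phi xP]; first exact: rmorph0.
    by rewrite rmorphD /= Ja // Jb // addr0.
  by rewrite rmorphM /= Jb // mulr0.
move=> S phi; split; last first.
  move=> x x' fx fx'; apply: corner_points_inj => k.
  by have := congr1 (fun f => f k) (etrans fx (esym fx')).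
split=> [xP a Ja|phiJ]; first exact: Ja.
have /all_sig[v v_gen] k : {v : taut (uQuot k) (y k) | part_generator (ek k None) v}.
  have [_ rk _] := taut_stable (uQuot k) (y k).
  by apply: cid; exact: free_rank1_generator rk.
have [u uP] := base_change_generators phi v_gen.
suff [x xy] : exists x : M S, forall k, c k S x = Defs.pmap phi (y k).
  by exists x; apply: functional_extensionality_dep.
apply: (glued_point (v := fun k => u k (v k))) => [k|k k' i b z Ii z0]; first by case: (uP k).
pose psi k := corner_orbit e (v k).
have u_psi j a : corner_orbit e (u j (v j)) a = u j (psi j a).
  by have [_ -> _] := uP j.
have [[n [s [p ps]]] _ _] := taut_stable (uQuot k) (y k).
have [[n' [s1 [p1 ps1]]] _ _] := taut_stable (uQuot k') (y k').
have [u_bc _ _] := uP k; have [u'_bc _ _] := uP k'.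
have [s' [s'u _]] := base_change_dual_basis u_bc ps.
have /choice[gz gzP] : forall t, exists z, p (delta_mx 0 t) = lsum (psi k) z.
  move=> t; have [zt ->] := taut_cyclic (@idem_ek k None) (v_gen k) (p (delta_mx 0 t)).
  exists (lmap val zt); rewrite lsum_map; apply: eq_lsum => a /=.
  by rewrite /psi (corner_orbit_val e_orth (ebE k)) //; case: (v_gen k).
pose theta a := psi k' (b * (e i * a)).
(* Over [S], b e_i a v_k' depends only on a v_k, and linearly so. This covers lists with arbitrary
   coefficients in [S]. *)
have u_theta a : u k' (theta a) = \sum_t s' (u k (psi k a)) 0 t *: u k' (lsum theta (gz t)).
  (* [a] minus the lift of the dual basis expansion of a v_k: a relation over [R]. *)
  pose kappa := [:: (1, a)] ++ lscale (-1)
    (flatten [seq lscale (s (psi k a) 0 t) (gz t) | t <- index_enum 'I_n]).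
  have kappa0 : lsum (psi k) kappa = 0.
    rewrite lsum_cat lsum1 lsum_scale lsum_comb {1}(dual_basisE ps (psi k a)) scaleN1r.
    by under [X in _ - X]eq_bigr do rewrite -gzP; rewrite subrr.
  (* At any point of [M] over [y], the relation [kappa] still kills the generator, so by
     [point_compat] the coordinates of b e_i kappa v_k' become 0. *)
  have coordJ t : J (s1 (lsum theta kappa) 0 t).
    move=> T chi [x fx]; have [g gP] := base_change_generators chi v_gen.
    have xy j : c j T x = Defs.pmap chi (y j) := congr1 (fun f => f j) fx.
    have g_gen j : part_generator (ek j None) (g j (v j)) by case: (gP j).
    have g_psi j a' : corner_orbit e (g j (v j)) a' = g j (psi j a').
      by have [_ -> _] := gP j.
    have [gk_bc _ _] := gP k; have [gk'_bc _ _] := gP k'.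
    have : lsum (corner_orbit e (g k (v k))) (lbase chi kappa) = 0.
      by rewrite (eq_lsum _ (g_psi k)) -(base_change_lsum gk_bc) kappa0 (base_change0 gk_bc).
    move/(point_compat xy g_gen k' b Ii).
    rewrite (eq_lsum (psi' := g k' \o theta)) => [|a']; last exact: g_psi.
    rewrite -(base_change_lsum gk'_bc) => g0.
    have [s2 [s2g _]] := base_change_dual_basis gk'_bc ps1.
    by have /rowP/(_ t) := s2g (lsum theta kappa); rewrite g0 linear0 !mxE.
  have u0 : u k' (lsum theta kappa) = 0.
    rewrite (dual_basisE ps1 (lsum theta kappa)) (base_change_sum u'_bc) big1 // => t _.
    by rewrite (phiJ _ (coordJ t)) scale0r.
  have -> : theta a = lsum theta kappa + \sum_t s (psi k a) 0 t *: lsum theta (gz t).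
    by rewrite lsum_cat lsum1 lsum_scale lsum_comb scaleN1r subrK.
  rewrite (base_changeD u'_bc) u0 add0r (base_change_sum u'_bc); apply: eq_bigr => t _.
  by rewrite s'u mxE.
rewrite (eq_lsum
  (psi' := fun a => \sum_t s' (u k (psi k a)) 0 t *: u k' (lsum theta (gz t)))); last first.
  by move=> a; rewrite -u_theta u_psi.
rewrite (lsum_sum _ _
  (fun t a => s' (u k (psi k a)) 0 t *: u k' (lsum theta (gz t)))) big1 // => t _.
rewrite (eq_lsum (psi := corner_orbit e (u k (v k))) (psi' := u k \o psi k)) in z0;
  last exact: u_psi.
(* By linearity the list z enters only through the coordinates of z v_k, which is 0. *)
transitivity (s' (lsum (u k \o psi k) z) 0 t *: u k' (lsum theta (gz t))).
  move: (u k' _) => D; rewrite /lsum linear_sum summxE scaler_suml; apply: eq_bigr => q _.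
  by rewrite [s' (_ *: _)]linearZ /= [in RHS]mxE scalerA.
by rewrite z0 linear0 mxE scale0r.
Qed.

End CorneringProduct.

(** * Specialisation to the McKay quiver *)

Lemma closed_immersion_iso (F : fieldType) (X X' Y : cfunctor F)
    (g : cmorphism X' Y) (f : cmorphism X X') :
  is_ciso f -> closed_immersion g -> closed_immersion (ccomp g f).
Proof.
move=> f_iso g_closed R y; have [J [idJ JP]] := g_closed R y.
exists J; split=> // S phi; have [x_iff x_inj] := JP S phi.
have [f' fK f'K] := f_iso S; split.
  rewrite -x_iff; split=> -[x gx]; first by exists (f S x).
  by exists (f' x); rewrite /= f'K.
by move=> x x' gx gx'; apply: (can_inj fK); exact: x_inj.
Qed.

Section McKayIdempotents.
Variables (F : fieldType) (gT : finGroupType) (G : {group gT}) (r : nat).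
Variables (d : 'I_r.+1 -> nat) (rho : forall i, mx_representation F G (d i)).
Variables (V : mx_representation F G 2) (eps : arrow rho V -> bool).

Lemma evert_orth i j : evert eps i * evert eps j = if i == j then evert eps i else 0.
Proof.
rewrite /evert /pi_A /pi_Pi /quot_proj.
apply: (etrans (esym (rmorphM (quot_pi _) _ _))).
apply: (etrans (congr1 _ (esym (rmorphM (quot_pi _) _ _)))).
rewrite pvertex_mul; case: ifP => _ //.
exact: (etrans (congr1 _ (rmorph0 (quot_pi _))) (rmorph0 (quot_pi _))).
Qed.

Lemma evert_sum : \sum_i evert eps i = 1.
Proof.
apply: (etrans (esym (rmorph_sum (quot_pi _) _ _ _))).
apply: (etrans (congr1 _ (esym (rmorph_sum (quot_pi _) _ _ _)))).
exact: (etrans (congr1 _ (rmorph1 (quot_pi _))) (rmorph1 (quot_pi _))).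
Qed.

End McKayIdempotents.

Theorem corollary1p3 (R : realType)
  (* a nontrivial finite subgroup G of SL(2, C), with given representation V *)
  (gT : finGroupType) (G : {group gT}) (V : mx_representation R[i] G 2)
  (V_faithful : mx_faithful V)
  (V_SL : forall g, g \in G -> \det (V g) = 1)
  (G_nontrivial : G :!=: 1%g)
  (* its irreducible representations *)
  (r : nat) (G_classes : #|classes G| = r.+1)
  (d : 'I_r.+1 -> nat) (rho : forall i, mx_representation R[i] G (d i))
  (rho_irr : irreducibles rho)
  (* the signs defining the preprojective algebra *)
  (eps : arrow rho V -> bool)
  (eps_opp : forall a, eps a != eps (opp_arrow a))
  (* non-empty subsets covering {0, ..., r} *)
  (l : nat) (I : 'I_l -> {set 'I_r.+1})
  (I_nonempty : forall k, I k != set0)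
  (I_cover : \bigcup_(k < l) I k = [set: 'I_r.+1])
  (n : 'I_r.+1 -> nat)
  (* Hilb^n([C^2/G]), identified with the moduli space M_A(1, n) *)
  (Hilb : cfunctor R[i]) (uHilb : hilb_scheme rho V n Hilb)
  (M : cfunctor R[i]) (uM : fine_moduli (evert eps) n M)
  (Phi : cmorphism Hilb M) (Phi_iso : is_ciso Phi)
  (* the Quot schemes, as the moduli spaces M_{A_I}(1, n_I) *)
  (Quot : 'I_l -> cfunctor R[i])
  (uQuot : forall k,
     fine_moduli (@evert_I _ _ _ _ _ rho V eps (I k)) (dim_restrict n) (Quot k))
  (* the cornering morphisms *)
  (c : forall k, cmorphism M (Quot k))
  (c_corner : forall k, is_cornering uM (uQuot k) (c k)) :
  closed_immersion (ccomp (cprod_mor c) Phi).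
Proof.
have cover w : exists k, w \in I k.
  have : w \in \bigcup_(k < l) I k by rewrite I_cover inE.
  by case/bigcupP => k _ wk; exists k.
(* Some subset contains the vertex 0, so there is at least one corner. *)
have l_gt0 : (0 < l)%N by have [k _] := cover ord0; apply: leq_ltn_trans (ltn_ord k).
apply: closed_immersion_iso Phi_iso _.
exact: (@cornering_closed_immersion _ _ _ (evert eps) (evert_orth eps) (evert_sum eps)
  l I l_gt0 cover (fun k => ebar eps (I k)) (fun k => erefl) (fun k => ebar_idem eps (I k))
  n M uM Quot uQuot c c_corner).
Qed.
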